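(* There is a function $f$, computable in polynomial time and with $f(I)$ bounded by a polynomial in $|I|$ for every instance $I$ of Exact Cover by 3-Sets, such that the following holds: every X3C-instance $I$ can be reduced (in polynomial time) to an instance of Possible Winner for any scoring vector that has $f(I)$ positions with different score values; i.e., for every scoring vector $(\alpha_1,\dots,\alpha_m)$ with at least $f(I)$ positions with pairwise different score values one can construct, in time polynomial in $|I|$ and $m$, a set $C$ of $m$ candidates, a list of partial votes on $C$ and a distinguished candidate $c$ such that $c$ is a possible winner with respect to $(\alpha_1,\dots,\alpha_m)$ if and only if $I$ is a yes-instance.
   Context: A scoring vector is $(\alpha_1,\dots,\alpha_m)$ with integers $\alpha_1\ge\dots\ge\alpha_m=0$; a candidate at position $j$ of a linear order gets $\alpha_j$ points. A partial vote on $C$ is a transitive antisymmetric relation; an extension replaces each partial vote by a linear order containing it. $c$ is a possible winner for a list of partial votes if some extension gives $c$ maximum total score (the result also holds for the unique-winner variant). Exact Cover by 3-Sets (X3C): given a set $E$ and a family $\mathcal S$ of 3-element subsets of $E$, decide whether some subfamily $\mathcal S'\subseteq\mathcal S$ covers each element of $E$ exactly once. *)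

(* Defs.v *)
From HB Require Import structures.
From mathcomp Require Import all_boot all_order all_algebra.
From mathcomp Require Import zify.
Set Implicit Arguments.
Unset Strict Implicit.
Unset Printing Implicit Defensive.

(** * Model of computation

    First-order list programs over S-expressions whose atoms are natural
    numbers, with cost semantics.  A primitive applied to [x] costs [dsize x];
    hence [eval p x t y] implies [dsize x <= t] and [dsize y <= t] (see
    [eval_cost]), so the cost accounts for all copying and for writing the output.  Atoms follow the
    uniform-cost RAM convention (an atom has size 1; addition, truncated
    subtraction and comparison are the only arithmetic).  A run of cost [t]
    only creates atoms of bit-length at most that of the input atoms and of the
    program constants plus [t], so cost and Turing machine time are
    polynomially related, up to the bit-length of the input atoms. *)
Inductive data : Type :=
| Atom of nat
| Cons of data & data.

Fixpoint dsize (x : data) : nat :=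
  if x is Cons a b then (dsize a + dsize b).+1 else 1.

Inductive prim : Type :=
| Id | Const of nat | Car | Cdr | IsCons | Add | Sub | Leq.

Definition run_prim (o : prim) (x : data) : data :=
  match o, x with
  | Id, _ => x
  | Const n, _ => Atom n
  | Car, Cons a _ => a
  | Cdr, Cons _ b => b
  | IsCons, Cons _ _ => Atom 1
  | Add, Cons (Atom a) (Atom b) => Atom (a + b)
  | Sub, Cons (Atom a) (Atom b) => Atom (a - b)
  | Leq, Cons (Atom a) (Atom b) => Atom (a <= b)
  | _, _ => Atom 0
  end.

Inductive prog : Type :=
| Prim of prim
| Fork of prog & prog
| Seq of prog & prog
| If of prog & prog & prog
| While of prog & prog.

(** [eval p x t y]: [p] halts on input [x] with output [y] at cost [t].  In
    tests, [Atom 0] is false and every other value is true. *)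
Inductive eval : prog -> data -> nat -> data -> Prop :=
| eval_prim o x : eval (Prim o) x (dsize x) (run_prim o x)
| eval_fork p q x s t a b :
    eval p x s a -> eval q x t b ->
    eval (Fork p q) x (s + t).+1 (Cons a b)
| eval_seq p q x s t y z :
    eval p x s y -> eval q y t z ->
    eval (Seq p q) x (s + t).+1 z
| eval_if_true b p q x s t v y :
    eval b x s v -> v <> Atom 0 -> eval p x t y ->
    eval (If b p q) x (s + t).+1 y
| eval_if_false b p q x s t y :
    eval b x s (Atom 0) -> eval q x t y ->
    eval (If b p q) x (s + t).+1 y
| eval_while_stop b p x s :
    eval b x s (Atom 0) ->
    eval (While b p) x s.+1 x
| eval_while_step b p x r s t v y z :
    eval b x r v -> v <> Atom 0 -> eval p x s y -> eval (While b p) y t z ->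
    eval (While b p) x (r + s + t).+1 z.

Lemma eval_cost (p : prog) (x : data) (t : nat) (y : data) :
  eval p x t y -> dsize x <= t /\ dsize y <= t.
Proof.
elim=> {p x t y}.
- move=> o x; split=> //.
  case: o => [|n||||||]; case: x => [a|[a|a a'] [b|b b']] //=; lia.
- by move=> p q x s t a b _ [] ? ? _ [] ? ?; split=> /=; lia.
- by move=> p q x s t y z _ [] ? ? _ [] ? ?; split; lia.
- by move=> b p q x s t v y _ [] ? ? _ _ [] ? ?; split; lia.
- by move=> b p q x s t y _ [] ? ? _ [] ? ?; split; lia.
- by move=> b p x s _ [] ? ?; split; lia.
- by move=> b p x r s t v y z _ [] ? ? _ _ [] ? ? _ [] ? ?; split; lia.
Qed.

Definition runs_within (p : prog) (x y : data) (bound : nat) : Prop :=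
  exists2 t, eval p x t y & t <= bound.

Definition enc_list (A : Type) (enc : A -> data) (s : seq A) : data :=
  foldr (fun a d => Cons (enc a) d) (Atom 0) s.

(** * Exact Cover by 3-Sets *)

Record x3c : Type := X3C {
  x3c_card : nat;
  x3c_family : seq {set 'I_x3c_card};
  x3c_family3 : all (fun s : {set _} => #|s| == 3) x3c_family
}.

Definition x3c_yes (I : x3c) : Prop :=
  exists2 S' : seq {set 'I_(x3c_card I)}, subseq S' (x3c_family I) &
    forall e, count (fun s : {set _} => e \in s) S' = 1.

(** The ground set is listed explicitly: an atom has size 1, so encoding it by
    its cardinality alone would make the size of the instance independent
    of it. *)
Definition enc_x3c (I : x3c) : data :=
  let enc_elt (e : 'I_(x3c_card I)) := Atom e in
  Cons (enc_list enc_elt (enum 'I_(x3c_card I)))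
       (enc_list (fun s : {set _} => enc_list enc_elt (enum s)) (x3c_family I)).

Definition x3c_size (I : x3c) : nat := dsize (enc_x3c I).

(** * Possible Winner *)

(** Natural-number entries lose nothing, as the entries are at least the last
    one, which is 0. *)
Definition scoring_vector (m : nat) (alpha : m.-tuple nat) : Prop :=
  [/\ 0 < m, sorted geq alpha & last 0 alpha = 0].

(** A vote is given by the list of its pairs; [(x, y)] means that [x] is
    preferred to [y].  Nothing is imposed on the diagonal, and linear orders
    are taken reflexive. *)
Definition vote (m : nat) : Type := seq ('I_m * 'I_m).

Definition vote_rel (m : nat) (v : vote m) : rel 'I_m :=
  fun x y => (x, y) \in v.

Definition partial_vote (m : nat) (v : vote m) : Prop :=
  transitive (vote_rel v) /\ antisymmetric (vote_rel v).

Definition linear_order (m : nat) (l : rel 'I_m) : Prop :=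
  [/\ total l, transitive l & antisymmetric l].

(** Positions are counted from 0. *)
Definition position (m : nat) (l : rel 'I_m) (x : 'I_m) : nat :=
  #|[set y | (y != x) && l y x]|.

Definition score (m : nat) (alpha : m.-tuple nat) (l : rel 'I_m) (x : 'I_m) :
    nat :=
  nth 0 alpha (position l x).

Definition extension (m : nat) (V : seq (vote m))
    (L : 'I_(size V) -> rel 'I_m) : Prop :=
  forall i, linear_order (L i) /\ subrel (vote_rel (tnth (in_tuple V) i)) (L i).

Definition total_score (m n : nat) (alpha : m.-tuple nat)
    (L : 'I_n -> rel 'I_m) (x : 'I_m) : nat :=
  \sum_(i < n) score alpha (L i) x.

Definition possible_winner (m : nat) (alpha : m.-tuple nat) (V : seq (vote m))
    (c : 'I_m) : Prop :=
  exists2 L : 'I_(size V) -> rel 'I_m, extension L &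
    forall d, total_score alpha L d <= total_score alpha L c.

Definition enc_input (I : x3c) (m : nat) (alpha : m.-tuple nat) : data :=
  Cons (enc_x3c I) (enc_list Atom alpha).

Definition enc_election (m : nat) (V : seq (vote m)) (c : 'I_m) : data :=
  let enc_pair (p : 'I_m * 'I_m) := Cons (Atom p.1) (Atom p.2) in
  Cons (enc_list (enc_list enc_pair) V) (Atom c).

(* Main.v *)
From Pilot Require Import Defs.
From HB Require Import structures.
From mathcomp Require Import all_boot all_order all_algebra.
From mathcomp Require Import zify.
(* [seq] exports a notation [Cons], which hides the constructor of [data]. *)
Import Pilot.Defs.
Set Implicit Arguments.
Unset Strict Implicit.
Unset Printing Implicit Defensive.

(** Candidates are a set of dummies, one candidate per element, one
    candidate [x_i] per set, a counter [s] and the distinguished candidate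
    [c]. The votes come in blocks of [m] rotations of one order, so that
    every candidate earns the same total in a block, up to a change in one
    of its votes.

    For a set [S_i], [x_i] may drop from the top score to the bottom of the
    dummies, but only if [s] moves up over the first drop of the scoring
    vector. For an element [e] of [S_i], [x_i] may overtake [e] at a
    position [j] where the scoring vector drops by little. Fixed exchanges
    are added so that, relative to [c], the counter can afford [n %/ 3]
    moves, each [x_i] can gain nothing unless it has dropped before, each
    [e] must be overtaken at least once, and dummies are harmless. As [j] is
    chosen such that three times its drop is at most the drop of [x_i], a
    dropped [x_i] can overtake its three elements: [c] wins iff at most
    [n %/ 3] sets cover all the elements, that is, iff there is an exact cover.
    Enough different score values guarantee three drops among the positions
    of the dummies, hence the existence of [j]. *)

(** * Polynomial-time functions *)

(** Cost bounds live in this class rather than in [{poly nat}]: composition and monotonicity follow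
    by induction, and [poly_bound_poly] produces a polynomial only at the very end. *)
Inductive poly_bound : (nat -> nat) -> Prop :=
| poly_bound_const c : poly_bound (fun=> c)
| poly_bound_id : poly_bound id
| poly_bound_add f g :
    poly_bound f -> poly_bound g -> poly_bound (fun n => f n + g n)
| poly_bound_mul f g :
    poly_bound f -> poly_bound g -> poly_bound (fun n => f n * g n).

Lemma poly_bound_comp f g :
  poly_bound f -> poly_bound g -> poly_bound (fun n => f (g n)).
Proof.
move=> pf pg; elim: pf => [c||f1 f2 _ IH1 _ IH2|f1 f2 _ IH1 _ IH2].
- exact: poly_bound_const.
- exact: pg.
- exact: poly_bound_add.
- exact: poly_bound_mul.
Qed.

Lemma poly_bound_mono f : poly_bound f -> {homo f : a b / a <= b}.
Proof.
elim=> {f} [c||f g _ IHf _ IHg|f g _ IHf _ IHg] a b le_ab //.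
- by rewrite leq_add ?IHf ?IHg.
- by rewrite leq_mul ?IHf ?IHg.
Qed.

Lemma poly_bound_poly f :
  poly_bound f -> exists p : {poly nat}, forall n, f n = (p.[n])%R.
Proof.
elim=> {f} [c||f g _ [p hp] _ [q hq]|f g _ [p hp] _ [q hq]].
- by exists (polyC c) => n; rewrite hornerC.
- by exists (polyX _) => n; rewrite hornerX.
- by exists (p + q)%R => n; rewrite hornerD hp hq.
- by exists (p * q)%R => n; rewrite hornerM hp hq.
Qed.

Ltac poly_bound_tac := repeat first
  [ assumption | apply: poly_bound_id | apply: poly_bound_const
  | apply: poly_bound_add | apply: poly_bound_mul
  | match goal with
    | H : poly_bound ?f |- poly_bound (fun n => ?f _) =>
        apply: (poly_bound_comp H)
    end ].

(** The program must compute [f] on every S-expression, not only on encodings, so that such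
    functions compose without side conditions. *)
Definition polytime (f : data -> data) : Prop :=
  exists p, exists2 b, poly_bound b &
    forall x, runs_within p x (f x) (b (dsize x)).

Lemma dsize_gt0 x : 0 < dsize x. Proof. by case: x. Qed.

(** Writing the output is part of the cost, so the time bound also bounds its size. *)
Lemma polytime_size f : polytime f ->
  exists2 b, poly_bound b & forall x, dsize (f x) <= b (dsize x).
Proof.
case=> p [b pb H]; exists b => // x; case: (H x) => t /eval_cost[_ h].
exact: leq_trans.
Qed.

Lemma polytime_prim o : polytime (run_prim o).
Proof.
exists (Prim o), id => [|x]; first exact: poly_bound_id.
by exists (dsize x) => //; apply: eval_prim.
Qed.

Lemma polytime_id : polytime id. Proof. exact: (polytime_prim Id). Qed.

Lemma polytime_const n : polytime (fun=> Atom n).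
Proof. exact: (polytime_prim (Const n)). Qed.

Lemma polytime_comp f g :
  polytime f -> polytime g -> polytime (fun x => g (f x)).
Proof.
case=> p [b pb Hp] [q [c pc Hq]].
exists (Seq p q), (fun n => b n + c (b n) + 1) => [|x]; first poly_bound_tac.
case: (Hp x) => t et lt; case: (Hq (f x)) => s es ls.
exists (t + s).+1; first exact: eval_seq et es.
have := poly_bound_mono pc (leq_trans (proj2 (eval_cost et)) lt); lia.
Qed.

Lemma polytime_cons f g :
  polytime f -> polytime g -> polytime (fun x => Cons (f x) (g x)).
Proof.
case=> p [b pb Hp] [q [c pc Hq]].
exists (Fork p q), (fun n => b n + c n + 1) => [|x]; first poly_bound_tac.
case: (Hp x) => t et lt; case: (Hq x) => s es ls.
exists (t + s).+1; [exact: eval_fork | lia].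
Qed.

Definition dif (b p q : data) : data := if b is Atom 0 then q else p.

Lemma polytime_if h f g : polytime h -> polytime f -> polytime g ->
  polytime (fun x => dif (h x) (f x) (g x)).
Proof.
case=> r [a pa Hr] [p [b pb Hp]] [q [c pc Hq]].
exists (If r p q), (fun n => a n + b n + c n + 1) => [|x].
  by poly_bound_tac.
case: (Hr x) => u eu lu; case: (Hp x) => t et lt; case: (Hq x) => s es ls.
have [E|N] : h x = Atom 0 \/ h x <> Atom 0.
  by case: (h x) => [[|k]|y z]; [left|right|right].
- exists (u + s).+1; last lia.
  by rewrite E /= in eu *; apply: eval_if_false.
- have -> : dif (h x) (f x) (g x) = f x by case: (h x) N => [[]|].
  by exists (u + t).+1; [apply: eval_if_true eu N et | lia].
Qed.

Definition dcar := run_prim Car.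
Definition dcdr := run_prim Cdr.
Definition dadd x y := run_prim Add (Cons x y).
Definition dsub x y := run_prim Sub (Cons x y).
Definition dleq x y := run_prim Leq (Cons x y).

(** Several arguments are packed into nested pairs, so that one closed program for [h] serves for
    all arguments. *)
Lemma polytime_comp2 h f g :
  polytime (fun z => h (dcar z) (dcdr z)) -> polytime f -> polytime g ->
  polytime (fun x => h (f x) (g x)).
Proof.
move=> ph pf pg; exact: (polytime_comp (polytime_cons pf pg) ph).
Qed.

Lemma polytime_comp3 h f g k :
  polytime (fun z => h (dcar z) (dcar (dcdr z)) (dcdr (dcdr z))) ->
  polytime f -> polytime g -> polytime k ->
  polytime (fun x => h (f x) (g x) (k x)).
Proof.
move=> ph pf pg pk.
exact: (polytime_comp (polytime_cons pf (polytime_cons pg pk)) ph).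
Qed.

Lemma polytime_car f : polytime f -> polytime (fun x => dcar (f x)).
Proof. by move=> pf; apply: (polytime_comp pf (polytime_prim Car)). Qed.
Lemma polytime_cdr f : polytime f -> polytime (fun x => dcdr (f x)).
Proof. by move=> pf; apply: (polytime_comp pf (polytime_prim Cdr)). Qed.
Lemma polytime_add f g :
  polytime f -> polytime g -> polytime (fun x => dadd (f x) (g x)).
Proof.
by move=> pf pg; apply: (polytime_comp (polytime_cons pf pg) (polytime_prim
  Add)).
Qed.
Lemma polytime_sub f g :
  polytime f -> polytime g -> polytime (fun x => dsub (f x) (g x)).
Proof.
by move=> pf pg; apply: (polytime_comp (polytime_cons pf pg) (polytime_prim
  Sub)).
Qed.
Lemma polytime_leq f g :
  polytime f -> polytime g -> polytime (fun x => dleq (f x) (g x)).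
Proof.
by move=> pf pg; apply: (polytime_comp (polytime_cons pf pg) (polytime_prim
  Leq)).
Qed.

(** * Folds over encoded lists *)

Fixpoint dfoldl (f : data -> data -> data) (acc l : data) : data :=
  if l is Cons y l' then dfoldl f (f acc y) l' else acc.

(** The accumulator grows by an amount that does not depend on its size, so it
    stays polynomially bounded along the whole iteration. *)
Lemma polytime_foldl (step : data -> data -> data -> data) init l b :
  polytime (fun z => step (dcar (dcar z)) (dcdr (dcar z)) (dcdr z)) ->
  polytime init -> polytime l -> poly_bound b ->
  (forall x acc y,
     dsize (step x acc y) <= dsize acc + b (dsize x + dsize y)) ->
  polytime (fun x => dfoldl (step x) (init x) (l x)).
Proof.
move=> pstep pinit pl pb size_step.
(* The loop state is the parameter [x], the accumulator and the rest of the list; [x] is carried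
   along because [step] may depend on it. *)
pose next st := Cons (dcar st) (Cons
  (step (dcar st) (dcar (dcdr st)) (dcar (dcdr (dcdr st))))
  (dcdr (dcdr (dcdr st)))).
have pnext : polytime next.
  apply: polytime_cons (polytime_prim Car) (polytime_cons _ _).
    have := @polytime_comp (fun st => Cons (Cons (dcar st) (dcar (dcdr st)))
      (dcar (dcdr (dcdr st)))) _ _ pstep; apply.
    apply: polytime_cons; first apply: polytime_cons.
    - exact: polytime_prim Car.
    - exact/polytime_car/(polytime_prim Cdr).
    - exact/polytime_car/polytime_cdr/(polytime_prim Cdr).
  exact/polytime_cdr/polytime_cdr/(polytime_prim Cdr).
have ptest : polytime (fun st => run_prim IsCons (dcdr (dcdr st))).
  apply: polytime_comp (polytime_prim IsCons).
  exact/polytime_cdr/(polytime_prim Cdr).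
case: pnext => P [tP pP HP]; case: ptest => T [tT pT HT].
(* [W] bounds the rest of the list and [S] the whole state. Consuming an entry shrinks the rest,
   which pays for the growth of the accumulator by at most [b (dsize x + W)]; hence [S] remains
   valid in all iterations. *)
have loop x W S lst : forall acc, dsize lst <= W ->
    dsize x + dsize acc + dsize lst * (b (dsize x + W)).+1 + 2 <= S ->
    runs_within (While T P) (Cons x (Cons acc lst))
      (Cons x (Cons (dfoldl (step x) acc lst)
        ((fix spine d := if d is Cons _ d' then spine d' else d) lst)))
      (dsize lst * (tP S + tT S + 1)).
  elim: lst => [k|y _ lst IH] acc leW leS.
    have [t et lt] := HT (Cons x (Cons acc (Atom k))).
    exists t.+1; first exact: eval_while_stop et.
    have : tT (dsize (Cons x (Cons acc (Atom k)))) <= tT S.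
      by apply: (poly_bound_mono pT) => /=; move: leS => /=; lia.
    by rewrite [dsize (Atom k)]/=; lia.
  set st := Cons x _.
  have leS' : dsize st <= S by move: leS; rewrite /st /=; nia.
  have [t et lt] := HT st; have [s es ls] := HP st.
  have lt' := poly_bound_mono pT leS'; have ls' := poly_bound_mono pP leS'.
  have hb : b (dsize x + dsize y) <= b (dsize x + W).
    by apply: (poly_bound_mono pb); move: leW => /=; lia.
  have := size_step x acc y.
  have [] := IH (step x acc y).
  - by move: leW => /=; lia.
  - have := size_step x acc y; move: leS => /=; nia.
  move=> u eu lu _; exists (t + s + u).+1; last by move: lu => /=; nia.
  exact: (eval_while_step et _ es eu).
case: (pinit) (pl) => I [tI pI HI] [L [tL pL HL]].
exists (Seq (Fork (Prim Id) (Fork I L)) (Seq (While T P)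
  (Seq (Prim Cdr) (Prim Car)))).
(* [S] bounds the initial state and [B] the cost of the loop, which runs at most as often as the
   size of the list. *)
pose S n := n + tI n + tL n * (b (n + tL n) + 1) + 2.
pose B n := tL n * (tP (S n) + tT (S n) + 1).
exists (fun n => n + tI n + tL n + 10 + 4 * B n).
  have pS : poly_bound S by rewrite /S; poly_bound_tac.
  by rewrite /B; poly_bound_tac.
move=> x; case: (HI x) (HL x) => u eu lu [v ev lv].
have [_ su] := eval_cost eu; have [_ sv] := eval_cost ev.
have bS : dsize x + dsize (init x) +
    dsize (l x) * (b (dsize x + tL (dsize x))).+1 + 2 <= S (dsize x).
  by rewrite /S; nia.
have [w ew lw] := loop x (tL (dsize x)) (S (dsize x)) (l x) (init x)
  (leq_trans sv lv) bS.
move: (eval_cost ew) => [_ sz].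
have := eval_seq (eval_fork (eval_prim Id x) (eval_fork eu ev))
  (eval_seq ew (eval_seq (eval_prim Cdr _) (eval_prim Car _))).
move=> E; eexists; first exact: E.
have leB : w <= B (dsize x).
  apply: leq_trans lw _; rewrite /B leq_mul2r (leq_trans sv lv); lia.
move: sz; rewrite /=; set g := dsize (dfoldl _ _ _).
set h := dsize (_ (l x)); lia.
Qed.

(** * List operations as folds *)

Fixpoint dlist (s : seq data) : data :=
  if s is x :: s' then Cons x (dlist s') else Atom 0.

Lemma enc_listE (A : Type) (enc : A -> data) s :
  enc_list enc s = dlist (map enc s).
Proof. by elim: s => //= a s <-. Qed.

Lemma dfoldlE f acc s : dfoldl f acc (dlist s) = foldl f acc s.
Proof. by elim: s acc => //=. Qed.

(** A left fold builds its output in reverse, whence the calls to [drev] below. With every operation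
    a fold, all running times reduce to [polytime_foldl]. *)
Definition dcatrev l acc := dfoldl (fun acc y => Cons y acc) acc l.
Definition drev l := dcatrev l (Atom 0).
Definition dcat l1 l2 := dcatrev (drev l1) l2.
Definition dflat l := dfoldl dcat (Atom 0) l.
Definition dmap f l := drev (dfoldl (fun acc y => Cons (f y) acc) (Atom 0) l).
Definition dfilter p l :=
  drev (dfoldl (fun acc y => dif (p y) (Cons y acc) acc) (Atom 0) l).
Definition dlen l := dfoldl (fun acc _ => dadd acc (Atom 1)) (Atom 0) l.
(** The next number is the length of what has been collected so far, so the state holds no separate
    counter. *)
Definition diota l := drev (dfoldl (fun acc _ =>
  Cons (dlen acc) acc) (Atom 0) l).
(** The state pairs a countdown with the remaining list, while [l] itself drives the loop. Out of
    range the result is [Atom 0]. *)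
Definition dnth k l := dcar (dcdr (dfoldl (fun st _ =>
  dif (dleq (Atom 1) (dcar st))
      (Cons (dsub (dcar st) (Atom 1)) (dcdr (dcdr st))) st) (Cons k l) l)).

Ltac polytime_step := first
  [ assumption | exact: polytime_id | exact: polytime_const
  | exact: (polytime_prim Car) | exact: (polytime_prim Cdr)
  | match goal with
    | |- polytime (fun x => Cons (@?f x) (@?g x)) => apply: (@polytime_cons f g)
    | |- polytime (fun x => dcar (@?f x)) => apply: (@polytime_car f)
    | |- polytime (fun x => dcdr (@?f x)) => apply: (@polytime_cdr f)
    | |- polytime (fun x => dadd (@?f x) (@?g x)) => apply: (@polytime_add f g)
    | |- polytime (fun x => dsub (@?f x) (@?g x)) => apply: (@polytime_sub f g)
    | |- polytime (fun x => dleq (@?f x) (@?g x)) => apply: (@polytime_leq f g)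
    | |- polytime (fun x => dif (@?h x) (@?f x) (@?g x)) =>
        apply: (@polytime_if h f g)
    end ].

Lemma dsize_dcatrev l acc : dsize (dcatrev l acc) <= dsize acc + dsize l.
Proof.
rewrite -[dsize l]muln1; elim: l acc => [c|y _ l IH] acc /=;
  first by rewrite leq_addr.
by apply: (leq_trans (IH _)) => /=; lia.
Qed.

Lemma polytime_catrev f g :
  polytime f -> polytime g -> polytime (fun x => dcatrev (f x) (g x)).
Proof.
move=> pf pg.
apply: (@polytime_foldl (fun _ acc y => Cons y acc) g f (fun n => n + 1)) => //.
- by repeat polytime_step.
- by poly_bound_tac.
- by move=> x acc y /=; lia.
Qed.

Lemma polytime_rev f : polytime f -> polytime (fun x => drev (f x)).
Proof. by move=> pf; apply: polytime_catrev => //; apply: polytime_const. Qed.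

Lemma polytime_cat f g :
  polytime f -> polytime g -> polytime (fun x => dcat (f x) (g x)).
Proof. by move=> pf pg; apply: polytime_catrev => //; apply: polytime_rev. Qed.

Lemma polytime_flat f : polytime f -> polytime (fun x => dflat (f x)).
Proof.
move=> pf.
apply: (@polytime_foldl (fun=> dcat) (fun=> Atom 0) f (fun n => n + 1)) => //.
- by apply: polytime_cat; repeat polytime_step.
- exact: polytime_const.
- by poly_bound_tac.
- move=> x acc y; have := dsize_dcatrev (drev acc) y.
  by have := dsize_dcatrev acc (Atom 0); rewrite /dcat /drev /=; lia.
Qed.

Lemma polytime_map (f : data -> data -> data) l :
  polytime (fun z => f (dcar z) (dcdr z)) -> polytime l ->
  polytime (fun x => dmap (f x) (l x)).
Proof.
move=> pf pl; apply: polytime_rev.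
have [b pb Hb] := polytime_size pf.
apply: (@polytime_foldl (fun x acc y => Cons (f x y) acc) (fun=> Atom 0) l
  (fun n => b (n + 1) + 1)) => //.
- apply: polytime_cons; last by repeat polytime_step.
  by apply: (polytime_comp2 pf); repeat polytime_step.
- exact: polytime_const.
- by poly_bound_tac.
- move=> x acc y /=; rewrite (addn1 (dsize x + _)).
  have : dsize (f x y) <= b (dsize x + dsize y).+1 := Hb (Cons x y); lia.
Qed.

Lemma polytime_filter (f : data -> data -> data) l :
  polytime (fun z => f (dcar z) (dcdr z)) -> polytime l ->
  polytime (fun x => dfilter (f x) (l x)).
Proof.
move=> pf pl; apply: polytime_rev.
apply: (@polytime_foldl (fun x acc y => dif (f x y) (Cons y acc) acc)
  (fun=> Atom 0) l (fun n => n + 1)) => //.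
- apply: polytime_if; try by repeat polytime_step.
  by apply: (polytime_comp2 pf); repeat polytime_step.
- exact: polytime_const.
- by poly_bound_tac.
- by move=> x acc y; case: (f x y) => [[|k]|? ?] /=; lia.
Qed.

Lemma polytime_len f : polytime f -> polytime (fun x => dlen (f x)).
Proof.
move=> pf.
apply: (@polytime_foldl (fun _ acc _ =>
  dadd acc (Atom 1)) (fun=> Atom 0) f id) => //.
- by repeat polytime_step.
- exact: polytime_const.
- exact: poly_bound_id.
- by move=> x [a|a b] y /=; lia.
Qed.

Lemma dsize_dlen l : dsize (dlen l) = 1.
Proof.
rewrite /dlen; have : dsize (Atom 0) = 1 by [].
by elim: l (Atom 0) => //= y _ l IH acc H; apply: IH; case: acc H.
Qed.

Lemma polytime_iota f : polytime f -> polytime (fun x => diota (f x)).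
Proof.
move=> pf; apply: polytime_rev.
apply: (@polytime_foldl (fun _ acc _ => Cons (dlen acc) acc) (fun=> Atom 0) f
  (fun=> 2)) => //.
- by apply: polytime_cons; [apply: polytime_len|]; repeat polytime_step.
- exact: polytime_const.
- exact: poly_bound_const.
- by move=> x acc y /=; rewrite dsize_dlen; lia.
Qed.

Lemma polytime_nth f g :
  polytime f -> polytime g -> polytime (fun x => dnth (f x) (g x)).
Proof.
move=> pf pg; apply/polytime_car/polytime_cdr.
apply: (@polytime_foldl (fun _ st _ => dif (dleq (Atom 1) (dcar st))
      (Cons (dsub (dcar st) (Atom 1)) (dcdr (dcdr st))) st) (fun x =>
        Cons (f x) (g x))
      g (fun=> 1)) => //.
- by repeat polytime_step.
- exact: polytime_cons.
- exact: poly_bound_const.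
- move=> x st y; rewrite /dif /dleq /dsub /dcar /dcdr.
  by case: st => [a|[[|k]|a a'] [b|b b']] /=; lia.
Qed.

Ltac polytime_tac := repeat first
  [ polytime_step
  | match goal with
    | |- polytime (fun x => drev (@?f x)) => apply: (@polytime_rev f)
    | |- polytime (fun x => dflat (@?f x)) => apply: (@polytime_flat f)
    | |- polytime (fun x => dlen (@?f x)) => apply: (@polytime_len f)
    | |- polytime (fun x => diota (@?f x)) => apply: (@polytime_iota f)
    | |- polytime (fun x => dcat (@?f x) (@?g x)) => apply: (@polytime_cat f g)
    | |- polytime (fun x => dnth (@?f x) (@?g x)) => apply: (@polytime_nth f g)
    | |- polytime (fun x => dmap (@?f x) (@?l x)) => apply: (@polytime_map f l)
    | |- polytime (fun x => dfilter (@?f x) (@?l x)) =>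
      apply: (@polytime_filter f l)
    end ].

(** * Values of the list operations on encoded lists *)

Lemma dcatrevE s t : dcatrev (dlist s) (dlist t) = dlist (catrev s t).
Proof. by rewrite /dcatrev dfoldlE; elim: s t => //= x s IH t;
  rewrite (IH (x :: t)). Qed.
Lemma drevE s : drev (dlist s) = dlist (rev s).
Proof. exact: (dcatrevE s [::]). Qed.
Lemma dcatE s t : dcat (dlist s) (dlist t) = dlist (s ++ t).
Proof. by rewrite /dcat drevE dcatrevE catrevE revK. Qed.
Lemma dflatE ss : dflat (dlist (map dlist ss)) = dlist (flatten ss).
Proof.
rewrite /dflat dfoldlE; suff H t : foldl dcat (dlist t) (map dlist ss) =
  dlist (t ++ flatten ss).
  exact: (H [::]).
elim: ss t => [|s ss IH] t /=; first by rewrite cats0.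
by rewrite dcatE IH catA.
Qed.
Lemma dmapE f s : dmap f (dlist s) = dlist (map f s).
Proof.
rewrite /dmap dfoldlE -(revK (map f s)) -drevE; congr drev.
rewrite -[rev _]cats0 -catrevE; change (Atom 0) with (dlist [::]).
by elim: s [::] => //= x s IH t; rewrite (IH (f x :: t)).
Qed.
Lemma dfilterE (A : Type) (enc : A -> data) f (p : pred A) s :
  (forall x, f (enc x) = Atom (p x)) ->
  dfilter f (dlist (map enc s)) = dlist (map enc (filter p s)).
Proof.
move=> H; rewrite /dfilter dfoldlE -(revK (map enc (filter p s))) -drevE.
congr drev; rewrite -[rev _]cats0 -catrevE; change (Atom 0) with (dlist [::]).
elim: s [::] => //= x s IH t; rewrite H /dif; case: (p x) => //=.
by rewrite -IH.
Qed.
Lemma dlenE s : dlen (dlist s) = Atom (size s).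
Proof.
rewrite /dlen dfoldlE; set step := (fun acc _ : data => _).
suff H k : foldl step (Atom k) s = Atom (k + size s) by exact: H.
by elim: s k => [|x s IH] k /=; rewrite ?addn0 // IH addn1 addSnnS.
Qed.
Lemma diotaE s : diota (dlist s) = dlist (map Atom (iota 0 (size s))).
Proof.
rewrite /diota dfoldlE -(revK (map Atom _)) -drevE; congr drev.
(* Induction from the end, since each new entry is the length of the accumulator built from all the
   earlier ones. *)
elim/last_ind: s => //= s x IH.
rewrite foldl_rcons IH size_rcons -addn1 iotaD map_cat rev_cat /= add0n.
by rewrite dlenE size_rev size_map size_iota.
Qed.
Lemma dnthE k s : dnth (Atom k) (dlist s) = nth (Atom 0) s k.
Proof.
rewrite /dnth dfoldlE; set step := (fun st _ : data => _).
(* The list driving the loop is separated from the remaining data; the inequality says that the loop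
   does not stop before the data run out. *)
suff H s1 s2 : size s2 <= size s1 ->
    dcar (dcdr (foldl step (Cons (Atom k) (dlist s2)) s1)) = nth (Atom 0) s2 k.
  exact: H.
elim: s1 s2 k => [|y s1 IH] s2 k /=.
  by case: s2 => //= _; rewrite nth_nil.
case: k => [|k] le_s.
  have stay u x : foldl step (Cons (Atom 0) u) x = Cons (Atom 0) u by elim: x.
  by rewrite /step /= -/step stay; case: s2 le_s.
have -> : step (Cons (Atom k.+1) (dlist s2)) y =
  Cons (Atom k) (dlist (behead s2)).
  by rewrite /step /dsub /= subn1; case: s2 {le_s}.
rewrite IH ?nth_behead //; by case: s2 le_s.
Qed.
Lemma dcarE s : dcar (dlist s) = head (Atom 0) s.
Proof. by case: s. Qed.

(** * Scores of blocks of votes *)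

(** A permutation of the numbers below [m], sending a candidate to its position; it acts on [nat]
    because positions are computed by plain arithmetic. *)
Definition ranking (m : nat) (key : nat -> nat) : Prop :=
  (forall u, u < m -> key u < m) /\
  (forall u v, u < m -> v < m -> key u = key v -> u = v).

(** The set is the preimage of an initial segment under a permutation. This is how [position], a
    cardinality, becomes a value of [key]. *)
Lemma card_ranking_lt m key k : ranking m key -> k <= m ->
  #|[set w : 'I_m | key w < k]| = k.
Proof.
move=> [key_lt key_inj] le_km.
pose h (w : 'I_m) := Ordinal (key_lt w (ltn_ord w)).
have h_inj : injective h.
  by move=> u v /(congr1 val) /= /key_inj E; apply/val_inj/E.
have -> : [set w : 'I_m | key w < k] = h @^-1: [set i : 'I_m | i < k].
  by apply/setP=> w; rewrite !inE.
rewrite card_preimset // -sum1dep_card -(big_ord_widen m (fun=> 1) le_km).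
by rewrite sum1_card card_ord.
Qed.

(** Pairs are listed row by row, exactly as [dvote] emits them: the program must output this very
    list, not just the same relation. *)
Definition order_of_rel (m : nat) (R : nat -> nat -> bool) : vote m :=
  [seq (u, v) | u : 'I_m <- enum 'I_m,
                v : 'I_m <- [seq v : 'I_m <- enum 'I_m | R u v]].

Lemma order_of_relE m R : vote_rel (order_of_rel m R) =2 (fun u v => R u v).
Proof.
move=> u v; apply/allpairsPdep/idP => [[u' [v' [_]]]|Ruv].
  by rewrite mem_filter => /andP[Ruv _] [-> ->].
by exists u, v; rewrite mem_enum (mem_filter _ v) Ruv mem_enum.
Qed.

(** Candidates of smaller key precede [x] by inclusion, and those of larger key cannot, by
    antisymmetry. *)
Lemma position_ranking m (l : rel 'I_m) key : linear_order l -> ranking m key ->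
  (forall u v : 'I_m, key u < key v -> l u v) ->
  forall x, position l x = key x.
Proof.
move=> [_ _ l_anti] rk sub x; case: (rk) => key_lt key_inj.
rewrite -[RHS](card_ranking_lt rk (ltnW (key_lt x (ltn_ord x)))).
apply: eq_card => w; rewrite !inE; case: (ltngtP (key w) (key x)) => [lt|lt|eq].
- by rewrite sub // andbT; apply: contraTneq lt => ->; rewrite ltnn.
- apply/negbTE/negP => /andP[ne lwx]; move/eqP: ne; apply.
  by apply: l_anti; rewrite lwx sub.
- by have /val_inj-> := key_inj _ _ (ltn_ord w) (ltn_ord x) eq; rewrite eqxx.
Qed.

Lemma linear_ranking m key : ranking m key ->
  linear_order (fun u v : 'I_m => key u <= key v).
Proof.
move=> [key_lt key_inj]; split.
- by move=> u v; apply: leq_total.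
- by move=> u v w; apply: leq_trans.
- move=> u v le; apply/val_inj/(key_inj _ _ (ltn_ord u) (ltn_ord v))/eqP.
  by rewrite eqn_leq.
Qed.

(** * Score functions reached by extensions *)

Fixpoint achievable (m : nat) (alpha : m.-tuple nat) (V : seq (vote m))
    (sigma : 'I_m -> nat) : Prop :=
  if V is v :: V' then
    exists l, exists2 sigma', achievable alpha V' sigma' &
      [/\ linear_order l, subrel (vote_rel v) l
        & forall u, sigma u = score alpha l u + sigma' u]
  else forall u, sigma u = 0.

Section Achievable.

Variables (m : nat) (alpha : m.-tuple nat).
Implicit Types (V : seq (vote m)) (sigma : 'I_m -> nat).

Lemma achievable_ext V sigma sigma' :
  sigma =1 sigma' -> achievable alpha V sigma -> achievable alpha V sigma'.
Proof.
move=> eqs; case: V => [|v V] /=; first by move=> H u; rewrite -eqs.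
by move=> [l [s' Hs [ll sl E]]]; exists l, s' => //; split=> // u; rewrite -eqs.
Qed.

(** Recursion over the votes avoids families of orders indexed by positions in [V], and makes
    concatenation of lists of votes an addition of scores. *)
Lemma achievableP V sigma : achievable alpha V sigma <->
  exists2 L : 'I_(size V) -> rel 'I_m, extension L &
    forall u, total_score alpha L u = sigma u.
Proof.
elim: V sigma => [|v V IH] sigma /=.
  split=> [H|[L _ H] u]; last by rewrite -H /total_score big_ord0.
  exists (fun _ _ _ => true) => [[]//|u].
  by rewrite /total_score big_ord0 H.
split=> [[l [s' /IH[L extL HL] [ll sl E]]]|[L extL HL]].
  exists (fun i : 'I_(size V).+1 => if unlift ord0 i is Some j then L j else l).
    move=> i; case: unliftP => [j|] ->; last first.
      by split=> //; rewrite (tnth_nth [::]).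
    case: (extL j) => lj sj; split=> //.
    by move: sj; rewrite !(tnth_nth [::]).
  move=> u; rewrite E /total_score big_ord_recl unlift_none -HL; congr (_ + _).
  by apply: eq_bigr => i _; rewrite liftK.
exists (L ord0), (fun u => \sum_(i < size V) score alpha (L (lift ord0 i)) u).
  apply/IH; exists (fun i => L (lift ord0 i)) => // i.
  by have := extL (lift ord0 i); rewrite !(tnth_nth [::]).
have := extL ord0; rewrite (tnth_nth [::]) /= => -[l0 s0]; split=> // u.
by rewrite -HL /total_score big_ord_recl.
Qed.

Lemma achievable_cat V1 V2 sigma : achievable alpha (V1 ++ V2) sigma <->
  exists s1 s2, [/\ achievable alpha V1 s1, achievable alpha V2 s2
                  & forall u, sigma u = s1 u + s2 u].
Proof.
elim: V1 sigma => [|v V1 IH] sigma /=.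
  split=> [H|[s1 [s2 [H1 H2 E]]]]; first by exists (fun=> 0), sigma.
  by apply: achievable_ext H2 => u; rewrite E H1.
split=> [[l [s' /IH[s1 [s2 [H1 H2 E']]] [ll sl E]]]|].
  exists (fun u => score alpha l u + s1 u), s2; split=> //.
    by exists l, s1.
  by move=> u; rewrite E E' addnA.
move=> [s1 [s2 [[l [s' H' [ll sl E1]]] H2 E]]].
exists l, (fun u => s' u + s2 u); first by apply/IH; exists s', s2.
by split=> // u; rewrite E E1 addnA.
Qed.

(** [uniq] allows the scores to be a function of the index itself; two occurrences of one index
    might be extended differently. *)
Lemma achievable_flatten (T : eqType) (F : T -> seq (vote m)) s sigma :
  uniq s -> achievable alpha (flatten (map F s)) sigma ->
  exists2 tau : T -> 'I_m -> nat,
    forall i, i \in s -> achievable alpha (F i) (tau i) &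
    forall u, sigma u = \sum_(i <- s) tau i u.
Proof.
elim: s sigma => [|i s IH] sigma /=.
  by move=> _ H; exists (fun _ _ => 0) => // u; rewrite big_nil H.
move=> /andP[iNs us] /achievable_cat[s1 [s2 [H1 /(IH _ us)[tau Ht Es] E]]].
exists (fun j => if j == i then s1 else tau j) => [j|u].
  by rewrite inE; case: eqP => [->|_ /Ht].
rewrite E Es big_cons eqxx; congr (_ + _); apply: eq_big_seq => j js.
by case: eqP => // ji; rewrite -ji js in iNs.
Qed.

Lemma achievable_flatten_sum (T : eqType) (F : T -> seq (vote m)) s tau :
  (forall i, i \in s -> achievable alpha (F i) (tau i)) ->
  achievable alpha (flatten (map F s)) (fun u => \sum_(i <- s) tau i u).
Proof.
elim: s => [|i s IH] H /=; first by move=> u; rewrite big_nil.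
apply/achievable_cat; exists (tau i), (fun u => \sum_(j <- s) tau j u).
split=> [||u]; last by rewrite big_cons.
- by apply: H; rewrite mem_head.
- by apply: IH => j js; apply: H; rewrite inE js orbT.
Qed.

Definition points k := nth 0 alpha k.

(** The strict order of a ranking already compares all distinct candidates, so every extension gives
    the same scores. *)
Lemma achievable_ranking v V key sigma :
  ranking m key -> vote_rel v =2 (fun u w => key u < key w) ->
  achievable alpha (v :: V) sigma <->
  exists2 sigma', achievable alpha V sigma' &
    forall u, sigma u = points (key u) + sigma' u.
Proof.
move=> rk ve; split=> /= [[l [s' H [ll sl E]]]|[s' H E]].
  exists s' => // u; rewrite E /score (position_ranking ll rk) // => x y lt.
  by apply: sl; rewrite ve.
exists (fun u w => key u <= key w), s' => //; split.
- exact: linear_ranking.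
- by move=> x y; rewrite ve => /ltnW.
move=> u; rewrite E /score (position_ranking (linear_ranking rk) rk) //.
by move=> x y /ltnW.
Qed.

Lemma achievable_rankings (T : eqType) (s : seq T) (key : T -> nat ->
  nat) v sigma :
  (forall i, i \in s -> ranking m (key i)) ->
  (forall i, i \in s -> vote_rel (v i) =2 (fun u w => key i u < key i w)) ->
  achievable alpha (map v s) sigma <->
  forall u, sigma u = \sum_(i <- s) points (key i u).
Proof.
elim: s sigma => [|i s IH] sigma rk ve.
  by split=> /= H u; rewrite H ?big_nil.
have {}IH sigma' : achievable alpha (map v s) sigma' <->
  forall u, sigma' u = \sum_(i <- s) points (key i u).
  by apply: IH => j js; [apply: rk|apply: ve]; rewrite inE js orbT.
rewrite map_cons (achievable_ranking _ _ (rk i (mem_head _ _)) (ve i (mem_head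
  _ _))).
split=> [[s' /IH Es E] u|E]; first by rewrite E Es big_cons.
exists (fun u => \sum_(i <- s) points (key i u)); first exact/IH.
by move=> u; rewrite E big_cons.
Qed.

End Achievable.

(** * Exchanges and rotations of positions *)

Definition transp (a b u : nat) : nat :=
  if u == a then b else if u == b then a else u.
(** First [y] and [p] are exchanged, then the image of [z] and [q]. If [y != z] and [p != q], the
    second exchange leaves [p], where [y] now is, alone. *)
Definition place (y z p q u : nat) : nat :=
  transp (transp y p z) q (transp y p u).
Definition rotate (m k u : nat) : nat :=
  if m <= u + k then u + k - m else u + k.

Lemma transpK a b : involutive (transp a b).
Proof. by move=> u; rewrite /transp; repeat case: ifP => //; lia. Qed.

Lemma ranking_transp m a b : a < m -> b < m -> ranking m (transp a b).
Proof.
move=> am bm; split=> [u um|u v _ _ /(congr1 (transp a b))].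
  by rewrite /transp; do 2!case: ifP => //.
by rewrite !transpK.
Qed.

Lemma ranking_comp m f g : ranking m f -> ranking m g ->
  ranking m (fun u => f (g u)).
Proof.
move=> [fm fi] [gm gi]; split=> [u um|u v um vm E]; first exact/fm/gm.
by apply: gi => //; apply: fi => //; apply: gm.
Qed.

Lemma ranking_rotate m k : k < m -> ranking m (rotate m k).
Proof.
by move=> km; split=> [u um|u v um vm]; rewrite /rotate; repeat case: ifP; lia.
Qed.

Lemma ranking_place m y z p q : y < m -> z < m -> p < m -> q < m ->
  ranking m (place y z p q).
Proof.
move=> *; apply: ranking_comp; last exact: ranking_transp.
by apply: ranking_transp => //; apply: (ranking_transp _ _).1.
Qed.

Lemma placel y z p q : y != z -> p != q -> place y z p q y = p.
Proof. by rewrite /place /transp; repeat case: ifP => //; lia. Qed.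

Lemma placer y z p q : place y z p q z = q.
Proof. by rewrite /place /transp eqxx. Qed.

Lemma place_id y z p q u : u != y -> u != z -> u != p -> u != q -> y != z ->
  z != p ->
  place y z p q u = u.
Proof. by rewrite /place /transp; repeat case: ifP => //; lia. Qed.

(** A block consists of the [m] rotations of the order [place y z p q], which
    puts [y] at position [p] and [z] at position [q]; only rotation [0] is
    altered: either [y] is made incomparable to positions [p + 1 .. r], or
    [y] and [z] are exchanged. *)
Record block := Block {
  blk_free : bool; blk_y : nat; blk_z : nat;
  blk_p : nat; blk_q : nat; blk_r : nat }.

Definition block_order (b : block) :=
  place (blk_y b) (blk_z b) (blk_p b) (blk_q b).

Definition block_rel (m : nat) (b : block) (k u v : nat) : bool :=
  let pi := block_order b in
  let tau := transp (blk_y b) (blk_z b) in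
  if k == 0 then
    if blk_free b then (pi u < pi v) && ~~ ((u == blk_y b) && (pi v <= blk_r b))
    else pi (tau u) < pi (tau v)
  else rotate m k (pi u) < rotate m k (pi v).

Definition block_votes (m : nat) (b : block) : seq (vote m) :=
  [seq order_of_rel m (block_rel m b k) | k <- iota 0 m].

Definition block_wf (m : nat) (b : block) : bool :=
  [&& blk_y b < m, blk_z b < m, blk_p b < m, blk_q b < m,
    blk_y b != blk_z b & blk_p b != blk_q b].

(** Deleting comparisons of [y] preserves transitivity because the candidates still below [y] form a
    final segment of the positions. *)
Lemma block_partial_vote m b v : v \in block_votes m b -> partial_vote v.
Proof.
move=> /mapP[k _ ->]; split=> [w u x|u w]; rewrite !order_of_relE /block_rel.
  case: ifP => // _; last by apply: ltn_trans.
  case: ifP => _; last exact: ltn_trans.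
  move=> /andP[lt1 h1] /andP[lt2 h2]; rewrite (ltn_trans lt1 lt2) /=.
  by case: eqP h1 => //= _; rewrite -!ltnNge => lt3; apply: ltn_trans lt2.
by case: ifP => _; first case: ifP => _; lia.
Qed.

(** * Scores in one block *)

Section BlockScores.

Variables (m : nat) (alpha : m.-tuple nat).
Hypothesis alpha_sorted : sorted geq alpha.
Local Notation pt := (points alpha).
Let T := \sum_(k < m) pt k.

Lemma points_anti i j : i <= j -> pt j <= pt i.
Proof.
move=> le; rewrite /points; have [jm|mj] := ltnP j (size alpha); last first.
  by rewrite nth_default.
have := sorted_leq_nth (rev_trans leq_trans) leqnn 0 alpha_sorted.
by move=> /(_ i j); rewrite !inE; apply=> //; apply: leq_ltn_trans jm.
Qed.

(** [rotate] is symmetric in the shift and the position, so a candidate meets every position once as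
    the shift varies. *)
Lemma rotations_sum w : w < m -> \sum_(k <- iota 0 m) pt (rotate m k w) = T.
Proof.
move=> wm; rewrite -[X in iota _ X]subn0 -/(index_iota 0 m) big_mkord.
have [rm ri] := ranking_rotate wm.
have rC k : rotate m k w = rotate m w k by rewrite /rotate addnC.
pose h (k : 'I_m) := Ordinal (rm k (ltn_ord k)).
rewrite /T [RHS](reindex_inj (h := h)) /=; first by apply: eq_bigr => k _;
  rewrite rC.
by move=> k k' /(congr1 val) /= /ri E; apply/val_inj/E.
Qed.

(** Without alteration everybody would earn [T]; only the contribution of rotation 0 is replaced.
    Both sides are sums, to keep clear of truncated subtraction. *)
Lemma block_votes_sum b sigma : 0 < m -> block_wf m b ->
  achievable alpha (block_votes m b) sigma <->
  exists2 s0, achievable alpha [:: order_of_rel m (block_rel m b 0)] s0 &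
    forall u : 'I_m, sigma u + pt (block_order b u) = s0 u + T.
Proof.
move=> m0 /and5P[ym zm pm qm _].
have rk : ranking m (block_order b) by apply: ranking_place.
rewrite /block_votes -[in iota 0 _](prednK m0) -[iota 0 _]/(0 :: iota 1 m.-1).
rewrite map_cons -cat1s achievable_cat.
pose rest (u : 'I_m) := \sum_(k <- iota 1 m.-1) pt (rotate m k (block_order b
  u)).
have restE (u : 'I_m) : pt (block_order b u) + rest u = T.
  rewrite -(rotations_sum (rk.1 u (ltn_ord u))).
  rewrite -[in iota 0 _](prednK m0) big_cons.
  by rewrite [rotate m 0 _]/rotate addn0 leqNgt (rk.1 u (ltn_ord u)).
have H sigma' := @achievable_rankings m alpha _ (iota 1 m.-1)
  (fun k u => rotate m k (block_order b u))
  (fun k => order_of_rel m (block_rel m b k)) sigma'.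
have {}H sigma' : achievable alpha [seq order_of_rel m (block_rel m b k) | k <-
  iota 1 m.-1]
  sigma' <-> sigma' =1 rest.
  apply: H => k; rewrite mem_iota => /andP[k0 km].
    by apply: ranking_comp => //; apply: ranking_rotate; lia.
  by move=> u v; rewrite order_of_relE /block_rel; case: eqP => //; lia.
split=> [[s1 [s2 [H1 /H H2 E]]]|[s0 H0 E]].
  by exists s1 => // u; rewrite E H2; have := restE u; lia.
exists s0, rest; split=> //; first exact/H.
by move=> u; have := restE u; have := E u; lia.
Qed.

(** In the altered vote [y] and [z] trade the positions [p] and [q]; the equation is additive since
    one of the two changes is a loss. *)
Lemma exchange_block_scores b sigma : 0 < m -> block_wf m b -> ~~ blk_free b ->
  achievable alpha (block_votes m b) sigma <->
  forall u : 'I_m,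
    sigma u + (u == blk_y b :> nat) * pt (blk_p b)
            + (u == blk_z b :> nat) * pt (blk_q b)
    = T + (u == blk_y b :> nat) * pt (blk_q b)
        + (u == blk_z b :> nat) * pt (blk_p b).
Proof.
move=> m0 wf nf; rewrite block_votes_sum //.
case/and5P: (wf) => ym zm pm qm /andP[yz pq].
have rk : ranking m (block_order b) by exact: ranking_place.
have rk' := ranking_comp rk (ranking_transp ym zm).
have H s0 := @achievable_rankings m alpha _ [:: 0]
  (fun _ u => block_order b (transp (blk_y b) (blk_z b) u))
  (fun k => order_of_rel m (block_rel m b k)) s0.
have {}H s0 : achievable alpha [:: order_of_rel m (block_rel m b 0)] s0 <->
  forall u : 'I_m, s0 u = pt (block_order b (transp (blk_y b) (blk_z b) u)).
  rewrite H => [|//|k]; last first.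
    by rewrite inE => /eqP-> u v;
      rewrite order_of_relE /block_rel /= (negPf nf).
  by split=> E u; rewrite E ?big_seq1.
have key (u : 'I_m) (x : nat) :
    (x + pt (block_order b u) =
      pt (block_order b (transp (blk_y b) (blk_z b) u)) + T)
    <-> (x + (u == blk_y b :> nat) * pt (blk_p b)
            + (u == blk_z b :> nat) * pt (blk_q b)
    = T + (u == blk_y b :> nat) * pt (blk_q b)
        + (u == blk_z b :> nat) * pt (blk_p b)).
  have ky : block_order b (blk_y b) = blk_p b by exact: placel.
  have kz : block_order b (blk_z b) = blk_q b by exact: placer.
  rewrite /transp; case: (eqVneq (u : nat) (blk_y b)) => [->|_].
    by rewrite (negPf yz) ky kz; lia.
  case: (eqVneq (u : nat) (blk_z b)) => [->|_]; first by rewrite ky kz; lia.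
  by lia.
split=> [[s0 /H E0 E] u|E]; first by apply/key; rewrite E E0.
exists (fun u => pt (block_order b (transp (blk_y b) (blk_z b) u)));
  first exact/H.
by move=> u; apply/key.
Qed.

Section FreeBlock.

Variable b : block.
Hypotheses (m0 : 0 < m) (wf : block_wf m b) (fr : blk_free b).
Hypotheses (qE : blk_q b = (blk_p b).+1) (qr : blk_q b <= blk_r b)
  (rm : blk_r b < m).
Local Notation y := (blk_y b).
Local Notation z := (blk_z b).
Local Notation p := (blk_p b).
Local Notation r := (blk_r b).
Local Notation pi := (block_order b).

Let yz : y != z. Proof. by case/and5P: wf => _ _ _ _ /andP[]. Qed.
Let zm : z < m. Proof. by case/and5P: wf. Qed.
Let ym : y < m. Proof. by case/and5P: wf. Qed.
Let rk : ranking m pi. Proof. by case/and5P: wf => *; apply: ranking_place. Qed.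
Let piy : pi y = p. Proof. by apply: placel => //; rewrite qE; lia. Qed.
Let piz : pi z = p.+1. Proof. by rewrite -qE; apply: placer. Qed.
Let pi_inj u v : u < m -> v < m -> pi u = pi v ->
  u = v. Proof. exact: rk.2. Qed.

(** The pair [y], [z] decides. If [y] stays above [z], nothing changes. Otherwise [z] takes position
    [p], [y] lands no lower than [r], and nobody placed outside [p .. r] moves. *)
Lemma free_block_scores sigma : achievable alpha (block_votes m b) sigma ->
  exists passed : bool, forall u : 'I_m,
    [/\ u != y :> nat -> u != z :> nat -> (pi u < p) || (r < pi u) ->
      sigma u = T,
        u = y :> nat -> T <= sigma u + passed * (pt p - pt r)
      & u = z :> nat -> sigma u = T + passed * (pt p - pt p.+1)].
Proof.
move=> /(block_votes_sum _ m0 wf)[s0 [l [s1 H1 [ll sl E0]]] E].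
have {}E (u : 'I_m) : sigma u + pt (pi u) = pt (position l u) + T.
  by rewrite E E0 H1 addn0.
have {}sl (u v : 'I_m) : pi u < pi v ->
  (u == y :> nat) && (pi v <= r) = false -> l u v.
  by move=> lt h; apply: sl; rewrite order_of_relE /block_rel /= fr lt h.
case: (ll) => l_tot l_tr l_anti.
pose yo := Ordinal ym; pose zo := Ordinal zm.
have asym (u v : 'I_m) : u != v -> l u v -> l v u = false.
  by move=> uv luv; apply: contraNF uv => lvu; apply/eqP/l_anti; rewrite luv.
have yzo : yo != zo by [].
have [lyz|lzy] := orP (l_tot yo zo).
  (* The comparisons deleted from [y] are recovered by transitivity through [z], which sits just
     below at [p + 1]. *)
  have pos := position_ranking ll rk; have {}pos x : position l x = pi x.
    apply: pos => u v lt; case: (boolP ((u == y :> nat) && (pi v <= r))) => h.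
      case/andP: h => /eqP uy vr; have -> : u = yo by apply: val_inj.
      have [->//|vz] := eqVneq v zo; apply: (l_tr zo) => //; apply: sl.
        have /eqP : pi v != pi z by apply: contra vz => /eqP /pi_inj h;
          apply/eqP/val_inj/h.
        by move: lt; rewrite uy piy piz /=; lia.
      by rewrite eq_sym (negPf yz).
    by apply: sl => //; apply/negbTE.
  have sT (u : 'I_m) : sigma u = T by have := E u; rewrite pos; lia.
  by exists false => u; rewrite sT !mul0n !addn0.
exists true => u; split.
- move=> uy uz out; suff -> : sigma u = T by [].
  suff pos : position l u = pi u by have := E u; rewrite pos; lia.
  rewrite -[RHS](card_ranking_lt rk (ltnW (rk.1 u (ltn_ord u)))).
  apply: eq_card => w; rewrite !inE; case: (ltngtP (pi w) (pi u)) => [lt|lt|eq].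
  + rewrite sl ?andbT; first by apply: contraTneq lt => ->; rewrite ltnn.
    by [].
    case: eqP => //= wy; move: out lt; rewrite wy piy; lia.
  + apply/negbTE/negP => /andP[wu]; apply/negP; rewrite asym //.
      by rewrite eq_sym.
    by apply: sl; rewrite ?(negPf uy).
  + by have /val_inj-> := pi_inj (ltn_ord w) (ltn_ord u) eq; rewrite eqxx.
- move=> uy; have -> : u = yo by apply: val_inj.
  suff pos : position l yo <= r.
    have := E yo; have := points_anti pos; rewrite piy /= mul1n.
    have : p <= r by lia.
    by move=> /points_anti; lia.
  (* Whoever is above [y] is among the [r] other candidates at positions [0 .. r], as the rest are
     still below [y] in the partial vote. *)
  have <- : #|[set w : 'I_m | pi w < r.+1] :\ yo| = r.
    have := cardsD1 yo [set w : 'I_m | pi w < r.+1].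
    rewrite card_ranking_lt // inE piy; have -> : p < r.+1 by lia.
    by lia.
  apply: subset_leq_card; apply/subsetP => w; rewrite !inE => /andP[-> lwy] /=.
  rewrite ltnS leqNgt; apply/negP => lt.
  have : l yo w by apply: sl; rewrite /= ?piy ?eqxx /=; lia.
  move=> lyw; have wy : w = yo by apply: l_anti; rewrite lwy.
  by move: lt; rewrite wy piy; lia.
- move=> uz; have -> : u = zo by apply: val_inj.
  suff pos : position l zo = p.
    have := E zo; rewrite pos piz mul1n.
    by have := points_anti (leqnSn p); lia.
  have pm : p <= m by have := ltn_ord yo; have := rk.1 _ ym; rewrite piy; lia.
  rewrite -[RHS](card_ranking_lt rk pm).
  apply: eq_card => w; rewrite !inE.
  have [->|wz] := eqVneq w zo; first by rewrite piz; lia.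
  case: (ltngtP (pi w) p) => [lt|lt|eq] /=.
  + by apply: sl; rewrite ?piz; first lia; case: eqP => //= wy; move: lt;
    rewrite wy piy ltnn.
  + apply: asym; first by rewrite eq_sym.
    apply: sl; last by rewrite eq_sym (negPf yz).
    have : pi w != pi z by apply: contra wz => /eqP /pi_inj h;
      apply/eqP/val_inj/h.
    by rewrite piz; lia.
  + have -> : w = yo by apply/val_inj/(pi_inj (ltn_ord w) ym); rewrite eq piy.
    by apply: asym => //; rewrite eq_sym.
Qed.

(** Both outcomes occur. The last clause is a crude bound for the dummies that may be shifted. *)
Lemma free_block_achievable (passed : bool) :
  exists2 sigma, achievable alpha (block_votes m b) sigma & forall u : 'I_m,
    [/\ u != y :> nat -> u != z :> nat -> (pi u < p) || (r < pi u) ->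
      sigma u = T,
        u = y :> nat -> sigma u + passed * (pt p - pt r) = T,
        u = z :> nat -> sigma u = T + passed * (pt p - pt p.+1)
      & sigma u <= T + pt 0].
Proof.
(* When passed, [y] goes down to [r] and the candidates at [p + 1 .. r] each move up by one. *)
pose drop (u : nat) := if u == y then r else if p < pi u <=
  r then (pi u).-1 else pi u.
have rk_drop : ranking m drop.
  split=> [u um|u v um vm]; rewrite /drop; have := rk.1 u um.
    by case: ifP => // _; case: ifP => // _; lia.
  move=> pu; case: (eqVneq u y) => [->|uy]; case: (eqVneq v y) => [->|vy] //.
  - case: ifP; last by lia.
    by lia.
  - by case: ifP; lia.
  - have : pi u != p by rewrite -piy; apply: contra uy => /eqP/pi_inj->.
    have : pi v != p by rewrite -piy; apply: contra vy => /eqP/pi_inj->.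
    by move=> ? ? E; apply: pi_inj => //; move: E; do 2!case: ifP; lia.
pose key := if passed then drop else pi.
have rk_key : ranking m key by rewrite /key; case: (passed).
pose sigma (u : 'I_m) := pt (key u) + T - pt (pi u).
(* This makes the subtraction in [sigma] exact. *)
have leT (u : 'I_m) : pt (pi u) <= T.
  by rewrite /T (bigD1 (Ordinal (rk.1 u (ltn_ord u)))) //= leq_addr.
exists sigma.
  apply/block_votes_sum => //; exists (fun u : 'I_m => pt (key u)); last first.
    by move=> u; rewrite /sigma; have := leT u; lia.
  exists (fun u v : 'I_m => key u <= key v), (fun=> 0) => //; split.
  - exact: linear_ranking.
  - move=> u v; rewrite order_of_relE /block_rel /= fr => /andP[lt].
    rewrite /key; case: (passed); last by move=> _; apply: ltnW.
    rewrite /drop; case: (eqVneq (u : nat) y) => /= [uy|uy] h.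
      case: (eqVneq (v : nat) y) => // vy; case: ifP; lia.
    case: (eqVneq (v : nat) y) => [vy|vy]; last by do 2!case: ifP; lia.
    by move: lt; rewrite vy piy; case: ifP; lia.
  - move=> u; rewrite addn0 /score (position_ranking (linear_ranking rk_key)
    rk_key) //.
    by move=> v w /ltnW.
move=> u; rewrite /sigma /key; have := leT u; split.
- move=> uy uz out; case: (passed) => /=; last by lia.
  by rewrite /drop (negPf uy); case: ifP; lia.
- move=> uy; rewrite uy piy /=;
  have := points_anti (leq_trans (leqnSn p) (eq_leq (esym qE))).
  have : pt r <= pt p by apply: points_anti; lia.
  move: (leT u); rewrite uy piy; case: (passed) => /=; rewrite ?piy;
    last by lia.
  by rewrite /drop eqxx; lia.
- move=> uz; move: (leT u); rewrite uz piz /=; have := points_anti (leqnSn p).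
  case: (passed) => /=; rewrite ?piz; last by lia.
  by rewrite /drop eq_sym (negPf yz) piz ltnSn -qE qr /= qE /=; lia.
- have := points_anti (leq0n (key u)); rewrite /key; lia.
Qed.

End FreeBlock.

End BlockScores.

(** * The reduction *)

(** Choice over a finite list, by induction and hence without an axiom; [b0] is the value off the
    list. *)
Lemma seq_choice (A : eqType) (B : Type) (b0 : B) (P : A -> B ->
  Prop) (s : seq A) :
  (forall i, i \in s -> exists x, P i x) ->
  exists f, forall i, i \in s -> P i (f i).
Proof.
elim: s => [|i s IH] H; first by exists (fun=> b0).
have [f Hf] := IH (fun j js => H j (mem_behead (s := i :: s) js)).
have [x Hx] := H i (mem_head _ _).
exists (fun j => if j == i then x else f j) => j; rewrite inE.
by case: eqP => [->|_ /= /Hf].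
Qed.

Lemma sum_const_seq (A : Type) (s : seq A) (c : nat) : \sum_(i <- s) c =
  size s * c.
Proof. by rewrite big_const_seq count_predT iter_addn_0 mulnC. Qed.

Lemma sum_mem_iota (n : nat) (s : seq nat) : uniq s ->
  {in s, forall e, e < n} ->
  \sum_(e <- iota 0 n) (e \in s : nat) = size s.
Proof.
move=> us lt_s; rewrite -big_mkcond sum1_count -size_filter; apply: perm_size.
apply: uniq_perm => //; first by rewrite filter_uniq ?iota_uniq.
move=> e; rewrite mem_filter mem_iota /=.
by case: (boolP (e \in s)) => //= /lt_s.
Qed.

Lemma sum_eq_iota (M lo k u : nat) :
  \sum_(e <- iota lo k) (u == M + e : nat) = (M + lo <= u < M + lo + k).
Proof.
elim: k lo => [|k IH] lo; first by rewrite big_nil; lia.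
by rewrite /= big_cons IH; lia.
Qed.

Lemma leq_const_sum (A : eqType) (s : seq A) (f : A -> nat) (c : nat) :
  (forall i, i \in s -> c <= f i) -> size s * c <= \sum_(i <- s) f i.
Proof.
by move=> ge_c; rewrite -sum_const_seq !big_seq; apply: leq_sum.
Qed.

Lemma leq_sum_const (A : eqType) (s : seq A) (f : A -> nat) (c : nat) :
  (forall i, i \in s -> f i <= c) -> \sum_(i <- s) f i <= size s * c.
Proof.
by move=> le_c; rewrite -sum_const_seq !big_seq; apply: leq_sum.
Qed.

(** A single excess raises the whole sum. It detects both a set candidate gaining points and an
    element covered too often. *)
Lemma leq_sum_jump (A : eqType) (s : seq A) (f : A -> nat) (x : A) (c d : nat) :
  x \in s -> (forall i, i \in s -> c <= f i) -> c + d <= f x ->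
  size s * c + d <= \sum_(i <- s) f i.
Proof.
elim: s => // i s IH; rewrite inE big_cons mulSn => xs ge_c fx.
have leI k : k \in s -> c <= f k.
  by move=> ks; apply: ge_c; rewrite inE ks orbT.
have [xE|xs'] : x = i \/ x \in s by case/orP: xs => [/eqP|]; [left|right].
  have := leq_const_sum leI.
  rewrite -xE => le; by rewrite addnAC leq_add.
by rewrite -addnA leq_add ?IH ?ge_c ?mem_head.
Qed.

(** * Lists of exchange blocks *)

Section ExchangeBlocks.

Variables (m : nat) (alpha : m.-tuple nat).
Hypotheses (alpha_sorted : sorted geq alpha) (m0 : 0 < m).
Local Notation pt := (points alpha).
Local Notation T := (\sum_(k < m) pt k).

Definition exchange (b : block) := block_wf m b && ~~ blk_free b.
(** Points of the two exchanged candidates before ([loss]) and after ([gain]) the exchange, kept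
    apart because their difference can be negative. *)
Definition loss u b := (u == blk_y b) * pt (blk_p b) +
  (u == blk_z b) * pt (blk_q b).
Definition gain u b := (u == blk_y b) * pt (blk_q b) +
  (u == blk_z b) * pt (blk_p b).

Lemma exchange_blocks_scores bs sigma : all exchange bs ->
  achievable alpha (flatten (map (block_votes m) bs)) sigma ->
  forall u : 'I_m, sigma u + \sum_(b <- bs) loss u b
    = size bs * T + \sum_(b <- bs) gain u b.
Proof.
elim: bs sigma => [|b bs IH] sigma /=.
  by move=> _ H u; rewrite H !big_nil mul0n.
move=> /andP[/andP[wf nf] ok] /achievable_cat[s1 [s2 [H1 H2 E]]] u.
have := (exchange_block_scores alpha_sorted _ m0 wf nf).1 H1 u.
have := IH s2 ok H2 u; rewrite !big_cons E mulSn.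
rewrite [loss u b]/loss [gain u b]/gain.
move: (\sum_(b <- bs) _) (\sum_(b <- bs) _) (size bs * T) => x y z.
set A := _ * pt (blk_p b); set B := _ * pt (blk_q b).
set C := _ * pt (blk_q b); set D := _ * pt (blk_p b); set S := \sum_(k < m) _.
lia.
Qed.

Lemma exchange_blocks_achievable bs : all exchange bs ->
  exists sigma, achievable alpha (flatten (map (block_votes m) bs)) sigma.
Proof.
elim: bs => [|b bs IH] /=; first by exists (fun=> 0).
move=> /andP[/andP[wf nf] /IH[s2 H2]].
(* The subtraction is exact: as [y] and [z] differ, a loss is at most one entry of the vector, hence
   at most [T]. *)
pose s1 (u : 'I_m) := T + gain u b - loss u b.
exists (fun u => s1 u + s2 u); apply/achievable_cat; exists s1, s2; split=> //.
apply/exchange_block_scores => // u; rewrite /s1 /gain /loss.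
case/and5P: wf => ym zm pm qm /andP[yz pq].
have leT k : k < m -> pt k <= T.
  by move=> km; rewrite (bigD1 (Ordinal km)) //= leq_addr.
have := leT _ pm; have := leT _ qm.
by case: (eqVneq (u : nat) (blk_y b)) => [->|_]; rewrite ?(negPf yz); lia.
Qed.

End ExchangeBlocks.

(** Candidates [0 .. M - 1] are the dummies, [M + e] is the element [e],
    [M + n + i] the set [i], [M + n + t] the counter and
    [m - 1 = M + n + t + 1] the distinguished candidate. *)
Definition set_block (M n t a i : nat) : block :=
  Block true (M + n + i) (M + n + t) a a.+1 M.-1.
Definition elt_block (M n j : nat) (ie : nat * nat) : block :=
  Block true (M + ie.2) (M + n + ie.1) j j.+1 j.+1.
Definition incidences (fam : seq (seq nat)) : seq (nat * nat) :=
  [seq (i, e) | i <- iota 0 (size fam), e <- nth [::] fam i].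

(** Each element moves from [j + 1] to [j], so it starts one drop above the level of [c] and must be
    overtaken to come back to it. *)
Definition raise_elts (M n j : nat) : seq block :=
  [seq Block false 0 (M + e) j j.+1 0 | e <- iota 0 n].
(** Every non-dummy, [c] included, gains the top score [m] times at the expense of dummy 0, since
    the last score is 0. The dummies cannot make up for this lead. *)
Definition sink_dummies (m M : nat) : seq block :=
  let zs := [seq z <- iota 0 m | M <= z] in
  flatten [seq [seq Block false 0 z 0 m.-1 0 | z <- zs] | _ <- iota 0 m].
(** The [k] with [3 * k + 3 <= n] number [n %/ 3]; counting them spares the program a division. *)
Definition lower_counter (m M n t a : nat) : seq block :=
  [seq Block false (M + n + t) 0 a a.+1 0
  | _ <- [seq k <- iota 0 m | 3 * k + 3 <= n]].

Definition reduction_blocks (m n : nat) (fam : seq (seq nat)) (a j : nat) :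
    seq block :=
  let t := size fam in
  let M := m - (n + t + 2) in
  map (set_block M n t a) (iota 0 t) ++
  (map (elt_block M n j) (incidences fam) ++
  (raise_elts M n j ++ (sink_dummies m M ++ lower_counter m M n t a))).

Definition reduction_votes m n fam a j : seq (vote m) :=
  flatten (map (block_votes m) (reduction_blocks m n fam a j)).

(** * Winners correspond to exact covers *)

Section Correctness.

Variables (m n : nat) (fam : seq (seq nat)) (alpha : m.-tuple nat) (a j : nat).
Local Notation t := (size fam).
Local Notation M := (m - (n + t + 2)).
Local Notation pt := (points alpha).
Local Notation T := (\sum_(k < m) pt k).
Local Notation K := (n %/ 3).
Hypotheses (alpha_sorted : sorted geq alpha) (alpha_last : pt m.-1 = 0).
Hypothesis fam_size : forall i, i < t -> size (nth [::] fam i) = 3.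
Hypothesis fam_uniq : forall i, uniq (nth [::] fam i).
Hypothesis fam_lt : forall i e, e \in nth [::] fam i -> e < n.
Hypothesis m_large : 2 * n + 5 * t + 6 <= m.
Hypotheses (a_lt : a.+1 < M) (a_top : pt a = pt 0) (a_drop : pt a.+1 < pt a).
Hypotheses (j_lt : j.+1 < M) (j_drop : pt j.+1 < pt j).
Hypothesis j_small : 3 * (pt j - pt j.+1) <= pt 0 - pt M.-1.

Let m0 : 0 < m. Proof. lia. Qed.

Lemma raise_elts_wf :
  all (exchange m) (raise_elts M n j).
Proof.
rewrite all_map; apply/allP => e; rewrite mem_iota => ? /=.
by rewrite /exchange /block_wf /=; lia.
Qed.

Lemma sink_dummies_wf :
  all (exchange m) (sink_dummies m M).
Proof.
rewrite /sink_dummies; set zs := filter _ _.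
have ok : all (exchange m) [seq Block false 0 z 0 m.-1 0 | z <- zs].
  rewrite all_map; apply/allP => z; rewrite mem_filter mem_iota => ? /=.
  by rewrite /exchange /block_wf /=; lia.
by elim: (iota 0 m) => //= _ s IH; rewrite all_cat ok.
Qed.

Lemma lower_counter_wf :
  all (exchange m) (lower_counter m M n t a).
Proof.
by rewrite all_map; apply/allP => k _ /=; rewrite /exchange /block_wf /=; lia.
Qed.

Local Notation exchanges :=
  (raise_elts M n j ++ (sink_dummies m M ++ lower_counter m M n t a)).

Lemma exchanges_wf : all (exchange m) exchanges.
Proof. by rewrite !all_cat raise_elts_wf sink_dummies_wf lower_counter_wf. Qed.

Lemma size_lower_counter : size (lower_counter m M n t a) = K.
Proof.
rewrite size_map -[RHS](size_iota 0).
have /(filter_iota_ltn 0) <- : K <= m by lia.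
by congr size; apply: eq_filter => k; lia.
Qed.

(** [F] stands for [loss] or [gain]; likewise in the next two lemmas. *)
Lemma raise_elts_sum (F : nat -> block -> nat) c d (u : nat) :
  (forall e, F u (Block false 0 (M + e) j j.+1 0) =
    (u == 0) * c + (u == M + e) * d) ->
  \sum_(b <- raise_elts M n j) F u b =
    (u == 0) * (n * c) + (M <= u < M + n) * d.
Proof.
move=> FE; rewrite big_map; under eq_bigr do rewrite FE.
rewrite big_split /= sum_const_seq size_iota -big_distrl sum_eq_iota addn0.
by case: (u == 0); rewrite ?mul1n ?mul0n ?muln0.
Qed.

Lemma sink_dummies_sum (F : nat -> block -> nat) c d (u : nat) : u < m ->
  (forall z, F u (Block false 0 z 0 m.-1 0) = (u == 0) * c + (u == z) * d) ->
  \sum_(b <- sink_dummies m M) F u b =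
    (u == 0) * (m * (m - M) * c) + (M <= u) * (m * d).
Proof.
move=> um FE; rewrite big_flatten big_map sum_const_seq size_iota big_map.
have -> : [seq z <- iota 0 m | M <= z] = iota M (m - M).
  rewrite -[X in iota 0 X](subnKC (leq_subr (n + t + 2) m)) iotaD filter_cat.
  rewrite (eq_in_filter (a2 := pred0)) ?filter_pred0; last first.
    by move=> z; rewrite mem_iota /=; lia.
  by rewrite (eq_in_filter (a2 := predT)) ?filter_predT // => z;
    rewrite mem_iota /=; lia.
under eq_bigr do rewrite FE.
rewrite big_split /= sum_const_seq size_iota -big_distrl (sum_eq_iota 0) /=.
by case: (u == 0); case: leqP => ?; rewrite ?mul0n ?mul1n; nia.
Qed.

Lemma lower_counter_sum (F : nat -> block -> nat) (u : nat) :
  \sum_(b <- lower_counter m M n t a) F u b =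
    K * F u (Block false (M + n + t) 0 a a.+1 0).
Proof. by rewrite -size_lower_counter big_map sum_const_seq size_map. Qed.

(** These are the starting levels: the set candidates and [c] are level, the counter is [K] drops at
    [a] lower, elements are one drop at [j] higher, and dummies lack the lead [m * pt 0]. *)
Lemma exchanges_scores sigma :
  achievable alpha (flatten (map (block_votes m) exchanges)) sigma ->
  forall u : 'I_m,
    (M <= u -> sigma u + (u == M + n + t :> nat) * (K * (pt a - pt a.+1))
      = size exchanges * T + m * pt 0 + (u < M + n) * (pt j - pt j.+1)) /\
    (u < M -> sigma u <= size exchanges * T + K * pt 0).
Proof.
move=> H u; have := exchange_blocks_scores alpha_sorted m0 exchanges_wf H u.
rewrite !big_cat /=.
rewrite (@raise_elts_sum (loss alpha) (pt j) (pt j.+1)) //.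
rewrite (@raise_elts_sum (gain alpha) (pt j.+1) (pt j)) //.
rewrite (@sink_dummies_sum (loss alpha) (pt 0) (pt m.-1)) //.
rewrite (@sink_dummies_sum (gain alpha) (pt m.-1) (pt 0)) //.
rewrite !lower_counter_sum /loss /gain /= alpha_last !muln0 !addn0 !add0n.
have ja := points_anti alpha_sorted (leqnSn j).
have aa := points_anti alpha_sorted (leqnSn a).
have jn : n * pt j.+1 <= n * pt j by rewrite leq_mul2l ja orbT.
have aK : K * pt a.+1 <= K * pt a by rewrite leq_mul2l aa orbT.
rewrite (mulnBr K) -a_top.
set B := _ * T; set X := _ * (m - M) * _; set Y := m * pt a.
move: (n * pt j) (n * pt j.+1) jn => c d cd.
move=> E; split=> Mu; move: E.
  have -> : (u == 0 :> nat) = false by lia.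
  have -> : M <= u by [].
  rewrite /=; case: (u < M + n); case: (_ == _);
    rewrite ?mul1n ?mul0n ?addn0 ?muln0; lia.
have -> : M <= u = false by lia.
have -> : (u == M + n + t :> nat) = false by lia.
by rewrite /=; case: (_ == _); rewrite ?mul1n ?mul0n ?add0n ?muln0; lia.
Qed.

Local Notation P := (incidences fam).

Lemma incidences_uniq : uniq P.
Proof.
apply: allpairs_uniq_dep => [|i _|[i e] [i' e'] _ _ /= [-> ->]] //.
exact: iota_uniq.
Qed.

Lemma mem_incidences i e : ((i, e) \in P) = (i < t) && (e \in nth [::] fam i).
Proof.
apply/allpairsPdep/andP => [[i' [e' [+ + [-> ->]]]]|[it ei]].
  by rewrite mem_iota.
by exists i, e; rewrite mem_iota.
Qed.

Lemma size_incidences : size P = 3 * t.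
Proof.
rewrite size_allpairs_dep sumnE big_map (eq_big_seq (fun=> 3)).
  by rewrite sum_const_seq size_iota mulnC.
by move=> i; rewrite mem_iota => /andP[_ it]; apply: fam_size.
Qed.

Lemma sum_incidences (F : nat * nat -> nat) :
  \sum_(x <- P) F x = \sum_(i <- iota 0 t) \sum_(e <- nth [::] fam i) F (i, e).
Proof. exact: big_allpairs_dep. Qed.

Lemma set_block_wf i : i < t -> block_wf m (set_block M n t a i).
Proof. by rewrite /block_wf /=; lia. Qed.

Lemma elt_block_wf x : x \in P -> block_wf m (elt_block M n j x).
Proof.
by case: x => i e; rewrite mem_incidences => /andP[it /fam_lt en];
  rewrite /block_wf /=; lia.
Qed.

(** As the drop at [a] is positive, the counter exceeds [T] exactly when it passed [x_i]. The move
    is thus read off the scores, and no choice over the blocks is needed. *)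
Lemma set_block_scores i sigma : i < t ->
  achievable alpha (block_votes m (set_block M n t a i)) sigma ->
  forall counter : 'I_m, counter = M + n + t :> nat ->
  forall u : 'I_m, M <= u ->
    [/\ u != M + n + i :> nat -> u != M + n + t :> nat -> sigma u = T,
        u = M + n + i :> nat -> ~~ (T < sigma counter) -> T <= sigma u
      & u = M + n + t :> nat ->
          sigma u = T + (T < sigma counter) * (pt a - pt a.+1)].
Proof.
move=> it H s sE u Mu.
have wf := set_block_wf it.
have [||||passed Hp] := free_block_scores alpha_sorted m0 wf _ _ _ _ H => //=;
  try lia.
have passedE : passed = (T < sigma s).
  have [_ _ /(_ sE) ->] := Hp s; rewrite /=; case: (passed); lia.
have [H1 H2 H3] := Hp u; rewrite -passedE; split.
- move=> u1 u2; apply: H1 => //=.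
  by rewrite /block_order /= place_id; lia.
- by move=> u1 np; have := H2 u1; rewrite (negPf np) mul0n addn0.
- exact: H3.
Qed.

(** Same device with the drop at [j]: here [mate] is the set candidate, and its score tells whether
    it overtook the element. *)
Lemma elt_block_scores x sigma : x \in P ->
  achievable alpha (block_votes m (elt_block M n j x)) sigma ->
  forall mate : 'I_m, mate = M + n + x.1 :> nat ->
  forall u : 'I_m, M <= u ->
    [/\ u != M + x.2 :> nat -> u != M + n + x.1 :> nat -> sigma u = T,
        u = M + x.2 :> nat -> ~~ (T < sigma mate) -> T <= sigma u
      & u = M + n + x.1 :> nat ->
          sigma u = T + (T < sigma mate) * (pt j - pt j.+1)].
Proof.
move=> xP H s sE u Mu.
have wf := elt_block_wf xP.
have [||||passed Hp] := free_block_scores alpha_sorted m0 wf _ _ _ _ H => //=;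
  try lia.
have passedE : passed = (T < sigma s).
  have [_ _ /(_ sE) ->] := Hp s; rewrite /=; case: (passed); lia.
have [H1 H2 H3] := Hp u; rewrite -passedE; split.
- move=> u1 u2; apply: H1 => //=.
  have [it en] : x.1 < t /\ x.2 < n.
    case: (x) xP => i e; rewrite mem_incidences => /andP[it /fam_lt]; by [].
  rewrite /block_order /=; move: (x.1) (x.2) it en u1 u2 => i e *.
  by rewrite place_id; lia.
- by move=> u1 np; have := H2 u1; rewrite (negPf np) mul0n addn0.
- exact: H3.
Qed.

(** Double counting of incidences: each selected set has three elements. *)
Lemma count_three (beta : nat -> bool) :
  \sum_(e <- iota 0 n) \sum_(i <- iota 0 t) (beta i &&
    (e \in nth [::] fam i) : nat)
  = 3 * \sum_(i <- iota 0 t) beta i.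
Proof.
rewrite exchange_big big_distrr /=; apply: eq_big_seq => i.
rewrite mem_iota => /andP[_ it]; case: (beta i) => /=; last first.
  by rewrite sum_const_seq !muln0.
rewrite sum_mem_iota ?fam_uniq ?fam_size // => e; exact: fam_lt.
Qed.

Lemma exact_cover_of_winner (c : 'I_m) : c = m.-1 :> nat ->
  possible_winner alpha (reduction_votes m n fam a j) c ->
  exists beta : nat -> bool, forall e, e < n ->
    \sum_(i <- iota 0 t) (beta i && (e \in nth [::] fam i) : nat) = 1.
Proof.
move=> cE [L extL maxL].
have := (achievableP alpha _ (total_score alpha L)).2 (ex_intro2 _ _ L extL
  (fun=> erefl)).
move: (total_score alpha L) maxL => sigma maxL.
rewrite /reduction_votes /reduction_blocks.
rewrite 2!(map_cat (block_votes m)) 2!flatten_cat -2!map_comp.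
case/achievable_cat=> s0 [s12 [H0 H12 E0]].
case/achievable_cat: H12 => s1 [s2 [H1 H2 E1]].
have [tau0 A0 S0] := achievable_flatten (iota_uniq 0 t) H0.
have [tau1 A1 S1] := achievable_flatten incidences_uniq H1.
have S2 := exchanges_scores H2.
have [s sE] : exists u : 'I_m, u = M + n + t :> nat.
  have lt : M + n + t < m by lia.
  by exists (Ordinal lt).
(* The default [s] is not reached for [i < t], where [M + n + i < m]. *)
pose x i : 'I_m := insubd s (M + n + i).
have xE i : i < t -> x i = M + n + i :> nat.
  by move=> it; rewrite val_insubd; case: ifP => //; lia.
(* [beta i]: the counter passed [x_i]. [gamma (i, e)]: [x_i] overtook [e]. *)
pose beta i := T < tau0 i s.
pose gamma ie := T < tau1 ie (x ie.1).
have F0 i (u : 'I_m) : i \in iota 0 t -> M <= u -> _ := fun iI Mu =>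
  set_block_scores (etrans (esym (mem_iota 0 t i)) iI) (A0 i iI) sE Mu.
have P1 ie : ie \in P -> ie.1 < t by case: ie => i e;
  rewrite mem_incidences => /andP[].
have P2 ie : ie \in P -> ie.2 < n.
  by case: ie => i e; rewrite mem_incidences => /andP[_ /fam_lt].
have F1 ie (u : 'I_m) (iP : ie \in P) (Mu : M <= u) :=
  elt_block_scores iP (A1 ie iP) (xE _ (P1 ie iP)) Mu.
have sz0 : size (iota 0 t) = t by apply: size_iota.
set B := size exchanges * T in S2.
have I0 i : i \in iota 0 t -> i < t by rewrite mem_iota.
have Ms : M <= s by lia.
have Mc : M <= c by lia.
have S1T (u : 'I_m) : M + n + t <= u -> \sum_(i <- P) tau1 i u = 3 * t * T.
  move=> ut; rewrite (eq_big_seq (fun=> T)) ?sum_const_seq ?size_incidences //.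
  move=> ie iP; have Mu : M <= u by lia.
  have [H _ _] := F1 ie u iP Mu; have := P1 ie iP; have := P2 ie iP.
  by move: (ie.1) (ie.2) H => i e H *; apply: H; lia.
(* No free block involves [c], so its score is the same in all extensions. *)
have cval : sigma c = t * T + 3 * t * T + (B + m * pt 0).
  rewrite E0 E1 S0 S1 S1T; last by lia.
  rewrite (eq_big_seq (fun=> T)); last first.
    move=> i iI; have [H _ _] := F0 i c iI Mc; have := I0 i iI => it.
    by apply: H; lia.
  rewrite sum_const_seq sz0; have [/(_ Mc)] := S2 c.
  have -> : (c == M + n + t :> nat) = false by lia.
  have -> : c < M + n = false by lia.
  by rewrite !mul0n !addn0 => -> _; rewrite addnA.
(* The counter starts [K] drops behind [c] and gains one with each move. *)
have beta_le : \sum_(i <- iota 0 t) beta i <= K.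
  have := maxL s; rewrite cval E0 E1 S0 S1 S1T; last by lia.
  rewrite (eq_big_seq (fun i => T + beta i * (pt a - pt a.+1))); last first.
    by move=> i iI; have [_ _ ->] := F0 i s iI Ms.
  rewrite big_split sum_const_seq sz0 -big_distrl /=.
  have [/(_ Ms) + _] := S2 s; rewrite sE eqxx mul1n.
  have -> : M + n + t < M + n = false by lia.
  rewrite mul0n addn0; move: (\sum_(i <- iota 0 t) _) => b.
  move: (t * T) (3 * t * T) (s2 s) => x1 x2 x3.
  by rewrite -/B; nia.
(* A set candidate that overtook an element without having dropped would exceed [c] by at least the
   drop at [j]. *)
have gamma_beta ie : ie \in P -> gamma ie -> beta ie.1.
  move=> iP gi; apply: contraT => nb; have it := P1 ie iP.
  have xi := xE _ it; have Mx : M <= x ie.1 by rewrite xi; move: (ie.1) => i;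
    lia.
  have := maxL (x ie.1); rewrite cval E0 E1 S0 S1.
  have /leq_trans h0 : t * T <= \sum_(i <- iota 0 t) tau0 i (x ie.1).
    rewrite -[X in X * _]sz0; apply: leq_const_sum => i iI.
    have [H1' H2' _] := F0 i (x ie.1) iI Mx.
    have [E|ne] := eqVneq i ie.1.
      by apply: H2'; rewrite E.
    rewrite H1' // xi; move: (ie.1) it ne => k; lia.
  have : size P * T + (pt j - pt j.+1) <= \sum_(i <- P) tau1 i (x ie.1).
    apply: (leq_sum_jump iP) => [i' iP'|].
      have [H1' _ H3'] := F1 i' (x ie.1) iP' Mx.
      have [E|ne] := eqVneq i'.1 ie.1.
        by rewrite H3' ?leq_addr // E.
      rewrite H1' // xi; have := P2 i' iP'; move: (ie.1) (i'.1) (i'.2) it ne;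
        lia.
    have [_ _ ->] := F1 ie (x ie.1) iP Mx => //.
    by rewrite -/(gamma ie) gi mul1n.
  have h1 := h0 _ (leqnn _).
  rewrite size_incidences; have [/(_ Mx) + _] := S2 (x ie.1).
  have -> : (x ie.1 == M + n + t :> nat) = false by rewrite xi;
    move: (ie.1) it; lia.
  have -> : x ie.1 < M + n = false by rewrite xi; lia.
  rewrite !mul0n !addn0 => ->; move: h1 j_drop.
  move: (\sum_(i <- iota 0 t) _) (\sum_(i <- P) _) (t * T) (3 * t * T) (m * pt
    0).
  by move=> *; lia.
exists beta.
(* An element that is never overtaken keeps its initial drop above [c]; the set that overtakes it is
   selected, by [gamma_beta]. *)
have ge1 e : e < n -> 1 <= \sum_(i <- iota 0 t) (beta i &&
  (e \in nth [::] fam i) : nat).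
  move=> en.
  have [u uE] : exists u : 'I_m, u = M + e :> nat.
    have lt : M + e < m by lia.
    by exists (Ordinal lt).
  have Mu : M <= u by lia.
  case: (boolP (has (fun ie => (ie.2 == e) && gamma ie) P)) =>
    [/hasP[[i e'] iP]|].
    move=> /andP[/= /eqP ee gi]; have bi := gamma_beta _ iP gi.
    move: iP; rewrite mem_incidences ee => /andP[it ei].
    have iI : i \in iota 0 t by rewrite mem_iota.
    have := @leq_sum_jump _ _
      (fun i => beta i && (e \in nth [::] fam i) : nat) _ 0 1 iI.
    by rewrite muln0 bi ei; apply.
  move=> /hasPn none; have := maxL u; rewrite cval E0 E1 S0 S1.
  rewrite (eq_big_seq (fun=> T)); last first.
    move=> i iI; have [H _ _] := F0 i u iI Mu; have it := I0 i iI.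
    by apply: H; lia.
  have : size P * T <= \sum_(i <- P) tau1 i u.
    apply: leq_const_sum => ie iP.
    have [H1' H2' _] := F1 ie u iP Mu.
    have [E|ne] := eqVneq ie.2 e.
      by apply: H2'; rewrite ?E //; have := none _ iP; rewrite E eqxx.
    rewrite H1' //; first by move: (ie.2) ne => k; lia.
    by move: (ie.1); lia.
  rewrite sum_const_seq sz0 size_incidences; have [/(_ Mu) + _] := S2 u.
  have -> : (u == M + n + t :> nat) = false by lia.
  have -> : u < M + n by lia.
  rewrite mul0n addn0 mul1n => ->; move: j_drop.
  move: (\sum_(i <- P) _) (t * T) (3 * t * T) (m * pt 0).
  by move=> *; lia.
(* If [e] were covered twice, the selected sets would have at least [n + 1] incidences, but at most
   [n %/ 3] sets of size 3 are selected. *)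
move=> e en; apply/eqP; rewrite eqn_leq ge1 // andbT leqNgt; apply/negP => gt1.
have eI : e \in iota 0 n by rewrite mem_iota.
have := @leq_sum_jump _ _ (fun e => \sum_(i <- iota 0 t)
  (beta i && (e \in nth [::] fam i) : nat)) _ 1 1 eI.
rewrite count_three size_iota => /(_ _ gt1) h.
have : n * 1 + 1 <= 3 * \sum_(i <- iota 0 t) beta i.
  by apply: h => e'; rewrite mem_iota => /andP[_ /ge1].
by move: beta_le; move: (\sum_(i <- _) _) => b; lia.
Qed.

Lemma set_block_achievable i (b : bool) : i < t -> exists sigma,
  achievable alpha (block_votes m (set_block M n t a i)) sigma /\
  forall u : 'I_m, sigma u <= T + pt 0 /\ (M <= u ->
    [/\ u != M + n + i :> nat -> u != M + n + t :> nat -> sigma u = T,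
        u = M + n + i :> nat -> sigma u + b * (pt 0 - pt M.-1) = T
      & u = M + n + t :> nat -> sigma u = T + b * (pt a - pt a.+1)]).
Proof.
move=> it; have wf := set_block_wf it.
have [||||sigma H Hs] := free_block_achievable alpha_sorted m0 wf _ _ _ _ b =>
  //=; try lia.
exists sigma; split=> // u; have [H1 H2 H3 H4] := Hs u; split=> // Mu; split.
- move=> u1 u2; apply: H1 => //=.
  by rewrite /block_order /= place_id; lia.
- by move=> u1; rewrite -a_top; apply: H2.
- exact: H3.
Qed.

Lemma elt_block_achievable x (b : bool) : x \in P -> exists sigma,
  achievable alpha (block_votes m (elt_block M n j x)) sigma /\
  forall u : 'I_m, sigma u <= T + pt 0 /\ (M <= u ->
    [/\ u != M + x.2 :> nat -> u != M + n + x.1 :> nat -> sigma u = T,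
        u = M + x.2 :> nat -> sigma u + b * (pt j - pt j.+1) = T
      & u = M + n + x.1 :> nat -> sigma u = T + b * (pt j - pt j.+1)]).
Proof.
move=> xP; have wf := elt_block_wf xP.
have [||||sigma H Hs] := free_block_achievable alpha_sorted m0 wf _ _ _ _ b =>
  //=; try lia.
exists sigma; split=> // u; have [H1 H2 H3 H4] := Hs u; split=> // Mu; split.
- move=> u1 u2; apply: H1 => //=.
  have [it en] : x.1 < t /\ x.2 < n.
    by case: (x) xP => i e; rewrite mem_incidences => /andP[it /fam_lt].
  rewrite /block_order /=; move: (x.1) (x.2) it en u1 u2 => i e *.
  by rewrite place_id; lia.
- exact: H2.
- exact: H3.
Qed.

Lemma winner_of_exact_cover (c : 'I_m) (beta : nat -> bool) : c = m.-1 :> nat ->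
  (forall e, e < n ->
    \sum_(i <- iota 0 t) (beta i && (e \in nth [::] fam i) : nat) = 1) ->
  possible_winner alpha (reduction_votes m n fam a j) c.
Proof.
move=> cE cover.
have beta_sum : 3 * \sum_(i <- iota 0 t) beta i = n.
  rewrite -count_three (eq_big_seq (fun=> 1)) ?sum_const_seq ?size_iota ?muln1
    //.
  by move=> e; rewrite mem_iota => /andP[_ /cover].
have I0 i : i \in iota 0 t -> i < t by rewrite mem_iota.
have P1 ie : ie \in P -> ie.1 < t by case: ie => i e;
  rewrite mem_incidences => /andP[].
have P2 ie : ie \in P -> ie.2 < n.
  by case: ie => i e; rewrite mem_incidences => /andP[_ /fam_lt].
(* The candidate of a set in the cover drops and overtakes all three of its elements; the other set
   candidates make no move. *)
have [tau0 H0] := seq_choice (fun=> 0) (fun i iI =>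
  set_block_achievable (beta i) (I0 i iI)).
have [tau1 H1] := seq_choice (fun=> 0) (fun x xP =>
  @elt_block_achievable x (beta x.1) xP).
have [s2 H2] := exchange_blocks_achievable alpha_sorted m0 exchanges_wf.
have S2 := exchanges_scores H2; set B := size exchanges * T in S2.
pose sigma u := \sum_(i <- iota 0 t) tau0 i u + (\sum_(x <- P) tau1 x u + s2 u).
have : achievable alpha (reduction_votes m n fam a j) sigma.
  rewrite /reduction_votes /reduction_blocks.
  rewrite 2!(map_cat (block_votes m)) 2!flatten_cat -2!map_comp.
  apply/achievable_cat; exists (fun u => \sum_(i <- iota 0 t) tau0 i u).
  exists (fun u => \sum_(x <- P) tau1 x u + s2 u); split=> //.
    by apply: achievable_flatten_sum => i /H0[].
  apply/achievable_cat; exists (fun u => \sum_(x <- P) tau1 x u), s2;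
    split=> //.
  by apply: achievable_flatten_sum => x /H1[].
case/achievableP=> L extL LE; exists L => // d; rewrite !LE {L extL LE}.
have F0 i u (iI : i \in iota 0 t) := (H0 i iI).2 u.
have F1 x u (xP : x \in P) := (H1 x xP).2 u.
have sz0 : size (iota 0 t) = t by apply: size_iota.
have const0 (u : 'I_m) : M <= u -> (u < M + n) || (M + n + t < u) ->
    \sum_(i <- iota 0 t) tau0 i u = t * T.
  move=> Mu ut; rewrite (eq_big_seq (fun=> T)) ?sum_const_seq ?sz0 // => i iI.
  have [_ /(_ Mu)[H _ _]] := F0 i u iI; have := I0 i iI => it; apply: H; lia.
have const1 (u : 'I_m) : M + n + t <= u -> \sum_(x <- P) tau1 x u = 3 * t * T.
  move=> ut; rewrite (eq_big_seq (fun=> T)) ?sum_const_seq ?size_incidences //.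
  move=> ie iP; have Mu : M <= u by lia.
  have [_ /(_ Mu)[H _ _]] := F1 ie u iP; have := P1 ie iP; have := P2 ie iP.
  by move: (ie.1) (ie.2) H => i e H *; apply: H; lia.
have Mc : M <= c by lia.
have -> : sigma c = t * T + (3 * t * T + (B + m * pt 0)).
  rewrite /sigma const0 ?const1; try lia.
  have [/(_ Mc) + _] := S2 c.
  have -> : (c == M + n + t :> nat) = false by lia.
  have -> : c < M + n = false by lia.
  by rewrite !mul0n !addn0 => ->.
have [dM|Md] := ltnP d M.
  have [_ /(_ dM) h2] := S2 d.
  have h0 : \sum_(i <- iota 0 t) tau0 i d <= t * (T + pt 0).
    by rewrite -[X in X * _]sz0; apply: leq_sum_const => i iI;
      have [] := F0 i d iI.
  have h1 : \sum_(x <- P) tau1 x d <= 3 * t * (T + pt 0).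
    by rewrite -size_incidences; apply: leq_sum_const => x xP;
      have [] := F1 x d xP.
  (* A dummy gains at most [pt 0] in each of the [t + 3 * t] free blocks and [K * pt 0] from the
     exchanges, which the lead [m * pt 0] absorbs. *)
  have h3 : (t + 3 * t + K) * pt 0 <= m * pt 0 by rewrite leq_mul2r; lia.
  rewrite /sigma; move: h0 h1 h2 h3; rewrite !mulnDr !mulnDl.
  move: (\sum_(i <- _) _) (\sum_(i <- _) _) (s2 d) (t * _) (3 * t * T) => *;
    lia.
have [/(_ Md) h2 _] := S2 d.
have [de|ed] := ltnP d (M + n).
  have dE : d = M + (d - M) :> nat by lia.
  rewrite /sigma const0; [|by []|by rewrite de].
  (* The element is covered once, hence overtaken once, and this cancels its initial advantage. *)
  have h1 : \sum_(x <- P) tau1 x d + (pt j - pt j.+1) = 3 * t * T.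
    have dn : d - M < n by lia.
    rewrite -(mul1n (pt j - _)) -[X in _ + X * _](cover _ dn).
    have -> : \sum_(i <- iota 0 t) (beta i &&
      (d - M \in nth [::] fam i) : nat) =
      \sum_(x <- P) ((x.2 == d - M) && beta x.1 : nat).
      rewrite sum_incidences; apply: eq_bigr => i _ /=; case: (beta i);
        last first.
        by rewrite big1 // => e _; rewrite andbF.
      rewrite /=; under eq_bigr do rewrite andbT.
      by rewrite -(count_uniq_mem _ (fam_uniq i)) -sum1_count big_mkcond.
    rewrite big_distrl -big_split /= (eq_big_seq (fun=> T)).
      by rewrite sum_const_seq size_incidences.
    move=> x xP; have [_ /(_ Md)[G1 G2 _]] := F1 x d xP.
    have [E|ne] := eqVneq x.2 (d - M).
      by apply: G2; rewrite E.
    rewrite mul0n addn0; apply: G1; first by move: (x.2) ne => k; lia.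
    by move: (x.1) => k; lia.
  move: h2; rewrite de mul1n; have -> : (d == M + n + t :> nat) = false by lia.
  rewrite mul0n addn0; move: h1;
    move: (\sum_(i <- _) _) (t * T) (3 * t * T) => *; lia.
move: h2; have -> : d < M + n = false by lia.
rewrite mul0n addn0.
have [ds|sd] := leqP (M + n + t) d.
  rewrite /sigma const1 //; have [dE|dE] := eqVneq (d : nat) (M + n + t);
    last first.
    rewrite const0; try lia.
  rewrite mul1n => h2.
  have -> : \sum_(i <- iota 0 t) tau0 i d
      = t * T + (\sum_(i <- iota 0 t) beta i) * (pt a - pt a.+1).
    rewrite (eq_big_seq (fun i => T + beta i * (pt a - pt a.+1))); last first.
      by move=> i iI; have [_ /(_ Md)[_ _ ->]] := F0 i d iI.
    by rewrite big_split sum_const_seq sz0 -big_distrl.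
  (* The cover has exactly [K] sets, so the counter ends level with [c]. *)
  have <- : K = \sum_(i <- iota 0 t) beta i by rewrite -beta_sum mulKn.
  by move: h2; move: (K * _) (t * T) (3 * t * T) => *; lia.
have -> : (d == M + n + t :> nat) = false by lia.
rewrite mul0n addn0 /sigma => ->.
have [k kt dE] : exists2 k, k < t & d = M + n + k :> nat.
  by exists (d - (M + n)); lia.
(* For a set candidate, the loss in [h0] is compared by [j_small] with the three gains in [h1]. *)
have h0 : \sum_(i <- iota 0 t) tau0 i d + beta k * (pt 0 - pt M.-1) = t * T.
  have -> : beta k * (pt 0 - pt M.-1) =
      \sum_(i <- iota 0 t) (k == 0 + i) * (beta k * (pt 0 - pt M.-1)).
    by rewrite -big_distrl sum_eq_iota /= add0n kt mul1n.
  rewrite -big_split /= (eq_big_seq (fun=> T)) ?sum_const_seq ?sz0 // => i iI.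
  have [_ /(_ Md)[G1 G2 _]] := F0 i d iI.
  rewrite add0n; have [E|ne] := eqVneq k i; first by rewrite mul1n E G2 // -E.
  by rewrite mul0n addn0 G1; lia.
have h1 : \sum_(x <- P) tau1 x d = 3 * t * T + 3 * (beta k * (pt j - pt j.+1)).
  have -> : \sum_(x <- P) tau1 x d =
      \sum_(x <- P) (T + (k == x.1) * (beta k * (pt j - pt j.+1))).
    apply: eq_big_seq => x xP; have [_ /(_ Md)[G1 _ G3]] := F1 x d xP.
    have [E|ne] := eqVneq k x.1; first by rewrite mul1n E G3 // dE E.
    rewrite mul0n addn0 G1 //; have := P2 x xP; move: (x.1) (x.2) ne; lia.
  rewrite big_split sum_const_seq size_incidences; congr (_ + _).
  rewrite sum_incidences (eq_big_seq (fun i =>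
    (k == 0 + i) * (3 * (beta k * (pt j - pt j.+1))))).
    by rewrite -big_distrl sum_eq_iota /= add0n kt mul1n.
  by move=> i /I0 it; rewrite /= sum_const_seq fam_size // add0n mulnCA.
rewrite h1; move: h0 j_small.
move: (\sum_(i <- _) _) (t * T) (3 * t * T) (B + _) => x1 x2 x3 x4.
by case: (beta k); rewrite ?mul1n ?mul0n; lia.
Qed.

End Correctness.

(** * Choice of the two drops *)

Section ChooseDrops.

Variables (m : nat) (alpha : m.-tuple nat) (M N : nat).
Local Notation pt := (points alpha).
Hypotheses (alpha_sorted : sorted geq alpha) (mE : m = M + N).

(** The last drop before [k] works: by monotonicity it is at most the total fall from [i] to [k]. *)
Lemma drop_between i k : i < k -> pt k < pt i ->
  exists d, [/\ i <= d < k, pt d.+1 < pt d & pt d - pt d.+1 <= pt i - pt k].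
Proof.
elim: k => // k IH ik lt.
have anti := points_anti alpha_sorted.
case: (ltnP (pt k.+1) (pt k)) => [drop|nodrop].
  exists k; split=> //; first by lia.
  by have := anti i k; lia.
have ki : i < k.
  rewrite ltn_neqAle; apply/andP; split; last by lia.
  by apply: contraTneq lt => ->; rewrite -leqNgt.
have [||d [d1 d2 d3]] := IH => //; first by lia.
by exists d; split=> //; [lia | have := anti k k.+1; lia].
Qed.

Lemma first_drop k : pt k < pt 0 ->
  exists d, [/\ d < k, pt d = pt 0 & pt d.+1 < pt d].
Proof.
elim: k => [|k IH] lt; first by rewrite ltnn in lt.
case: (ltnP (pt k) (pt 0)) => [/IH[d [? ? ?]]|ge]; first by exists d;
  split=> //; lia.
have kE : pt k = pt 0 by have := points_anti alpha_sorted (leq0n k); lia.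
by exists k; rewrite kE.
Qed.

(** At most [N] of the positions in [J] are among the last [N], so four are below [M]; distinct
    scores in a sorted vector decrease strictly. *)
Lemma four_values (J : {set 'I_m}) : {in J &, injective (tnth alpha)} ->
  N + 4 <= #|J| ->
  exists i1 i2 i3 i4, [/\ i1 < i2, i2 < i3, i3 < i4 & i4 < M] /\
    [/\ pt i2 < pt i1, pt i3 < pt i2 & pt i4 < pt i3].
Proof.
move=> injJ cardJ; pose Jn := map val (enum J).
have distinct i k : i \in Jn -> k \in Jn -> i < k -> pt k < pt i.
  move=> /mapP[u uJ ->] /mapP[v vJ ->] lt.
  rewrite !mem_enum in uJ vJ.
  have := points_anti alpha_sorted (ltnW lt);
    rewrite leq_eqVlt => /orP[/eqP E|//].
  have /injJ : tnth alpha u = tnth alpha v by rewrite !(tnth_nth 0) -/(pt _) -E.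
  by move=> /(_ uJ vJ) uv; rewrite uv ltnn in lt.
pose s := [seq i <- iota 0 M | i \in Jn].
have sz : 4 <= size s.
  have szJ : size [seq i <- iota 0 m | i \in Jn] = #|J|.
    rewrite cardE -(size_map val); apply: perm_size; apply: uniq_perm.
    - by rewrite filter_uniq ?iota_uniq.
    - by rewrite map_inj_uniq ?enum_uniq //; apply: val_inj.
    - move=> i; rewrite mem_filter mem_iota /= andbC.
      by case: (boolP (i \in Jn)) => [/mapP[u _ ->]|]; rewrite ?ltn_ord ?andbF.
  move: szJ; rewrite [in iota 0 m]mE iotaD filter_cat size_cat -/s => szJ.
  have : size [seq i <- iota (0 + M) N | i \in Jn] <= N.
    by rewrite size_filter (leq_trans (count_size _ _)) // size_iota.
  by lia.
have ss : sorted ltn s by apply: sorted_filter;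
  [apply: ltn_trans | apply: iota_ltn_sorted].
have sP i : i \in s -> i < M /\ i \in Jn.
  by rewrite mem_filter mem_iota => /andP[-> ]; split; lia.
case: s sz ss sP => [|i1 [|i2 [|i3 [|i4 s]]]] //= _ /and4P[l12 l23 l34 _] sP.
have in1 : i1 \in Jn by apply: (sP i1 _).2; rewrite !inE eqxx.
have in2 : i2 \in Jn by apply: (sP i2 _).2; rewrite !inE eqxx ?orbT.
have in3 : i3 \in Jn by apply: (sP i3 _).2; rewrite !inE eqxx ?orbT.
have [i4M in4] : i4 < M /\ i4 \in Jn by apply: sP; rewrite !inE eqxx ?orbT.
by exists i1, i2, i3, i4; do 2!split=> //; apply: distinct.
Qed.

(** For a sorted vector [pt 0 <= pt k] means equality with the top score. *)
Definition is_top_drop k := [&& k.+1 < M, pt 0 <= pt k & pt k.+1 < pt k].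
Definition is_small_drop k :=
  [&& k.+1 < M, pt k.+1 < pt k & 3 * (pt k - pt k.+1) <= pt 0 - pt M.-1].
(** Defined as the first hit of a search, so that the program can find the same position. *)
Definition top_drop := head 0 [seq k <- iota 0 m | is_top_drop k].
Definition small_drop := head 0 [seq k <- iota 0 m | is_small_drop k].

Lemma head_filter_iota (p : pred nat) k : k < m -> p k ->
  p (head 0 [seq i <- iota 0 m | p i]).
Proof.
move=> km pk; have : k \in [seq i <- iota 0 m | p i] by rewrite mem_filter pk
  mem_iota.
case E: [seq i <- _ | _] => [|i s] //= _.
have : i \in [seq i <- iota 0 m | p i] by rewrite E mem_head.
by rewrite mem_filter => /andP[].
Qed.

Lemma drops_exist (J : {set 'I_m}) : {in J &, injective (tnth alpha)} ->
  N + 4 <= #|J| -> is_top_drop top_drop /\ is_small_drop small_drop.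
Proof.
move=> injJ /(four_values injJ)[i1 [i2 [i3 [i4 [[l12 l23 l34 l4M] [d12 d23
  d34]]]]]].
have anti := points_anti alpha_sorted.
have [h1 h4] : pt i1 <= pt 0 /\ pt M.-1 <= pt i4 by split; apply: anti; lia.
split.
  have [|d [d1 d2 d3]] := @first_drop M.-1; first by lia.
  by apply: (@head_filter_iota is_top_drop d); rewrite /is_top_drop ?d2; lia.
have [x [x1 x2 x3]] := drop_between l12 d12.
have [y [y1 y2 y3]] := drop_between l23 d23.
have [z [z1 z2 z3]] := drop_between l34 d34.
have found k : k.+1 < M -> pt k.+1 < pt k ->
    3 * (pt k - pt k.+1) <= pt 0 - pt M.-1 -> is_small_drop small_drop.
  by move=> *; apply: (@head_filter_iota is_small_drop k);
    rewrite /is_small_drop; lia.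
(* The three gaps between the four values fit into the range from [pt 0] to [pt M.-1], so the drops
   inside them cannot all exceed a third of it. *)
case: (leqP (3 * (pt x - pt x.+1)) (pt 0 - pt M.-1)) => [/found|];
  first by apply; lia.
case: (leqP (3 * (pt y - pt y.+1)) (pt 0 - pt M.-1)) => [/found|];
  first by move=> h _; apply: h; lia.
case: (leqP (3 * (pt z - pt z.+1)) (pt 0 - pt M.-1)) => [/found|];
  first by move=> h _ _; apply: h; lia.
by lia.
Qed.

End ChooseDrops.

(** * Exact covers as selections of indices *)

Lemma count_mask (A : Type) (x0 : A) (p : pred A) bs (s : seq A) :
  count p (mask bs s) =
  \sum_(i <- iota 0 (size s)) (nth false bs i && p (nth x0 s i) : nat).
Proof.
elim: s bs => [|x s IH] [|b bs] //=.
- by rewrite big_nil.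
- by rewrite big_nil.
- by rewrite big_cons big1 // => i _; rewrite nth_nil.
rewrite big_cons (iotaDl 1 0) big_map; case: b => /=; rewrite IH //.
Qed.

Definition family_lists (I : x3c) : seq (seq nat) :=
  [seq map val (enum X) | X : {set 'I_(x3c_card I)} <- x3c_family I].

Lemma mem_family_lists I i (e : 'I_(x3c_card I)) :
  (val e \in nth [::] (family_lists I) i) = (e \in nth set0 (x3c_family I) i).
Proof.
have [it|ti] := ltnP i (size (x3c_family I)); last first.
  by rewrite !nth_default ?size_map // inE.
by rewrite (nth_map set0) // mem_map ?mem_enum //; apply: val_inj.
Qed.

(** A subsequence is a mask, that is, a selection of indices; repeated sets in the family therefore
    stay separate. *)
Lemma x3c_yesE (I : x3c) : x3c_yes I <->
  exists beta : nat -> bool, forall e, e < x3c_card I ->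
    \sum_(i <- iota 0 (size (family_lists I)))
      (beta i && (e \in nth [::] (family_lists I) i) : nat) = 1.
Proof.
have sumE (bs : nat -> bool) (e : 'I_(x3c_card I)) :
    \sum_(i <- iota 0 (size (family_lists I)))
      (bs i && (val e \in nth [::] (family_lists I) i) : nat) =
    \sum_(i <- iota 0 (size (x3c_family I)))
      (bs i && (e \in nth set0 (x3c_family I) i) : nat).
  by rewrite size_map; apply: eq_bigr => i _; rewrite mem_family_lists.
split=> [[S' /subseqP[bs sz ->] cov]|[beta cov]].
  exists (nth false bs) => e en.
  rewrite -[e]/(val (Ordinal en)) sumE -(cov (Ordinal en)).
  by rewrite (count_mask set0).
exists (mask (map beta (iota 0 (size (x3c_family I)))) (x3c_family I)).
  exact: mask_subseq.
move=> e; rewrite (count_mask set0) -[RHS](cov e (ltn_ord e)) sumE.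
apply: eq_big_seq => i; rewrite mem_iota => /andP[_ it].
by rewrite (nth_map 0) ?size_iota // nth_iota.
Qed.

(** * Computing the reduction *)

Definition deq x y := dif (dleq x y) (dleq y x) (Atom 0).
Definition dlt x y := dleq (dadd x (Atom 1)) y.
Definition dtransp a b u := dif (deq u a) b (dif (deq u b) a u).
Definition drotate m k u :=
  dif (dleq m (dadd u k)) (dsub (dadd u k) m) (dadd u k).

Lemma polytime_eq f g :
  polytime f -> polytime g -> polytime (fun x => deq (f x) (g x)).
Proof. by move=> pf pg; rewrite /deq; polytime_tac. Qed.
Lemma polytime_lt f g :
  polytime f -> polytime g -> polytime (fun x => dlt (f x) (g x)).
Proof. by move=> pf pg; rewrite /dlt; polytime_tac. Qed.
Lemma polytime_transp f g h : polytime f -> polytime g -> polytime h ->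
  polytime (fun x => dtransp (f x) (g x) (h x)).
Proof.
move=> pf pg ph; rewrite /dtransp /deq; polytime_tac.
Qed.
Lemma polytime_rotate f g h : polytime f -> polytime g -> polytime h ->
  polytime (fun x => drotate (f x) (g x) (h x)).
Proof. by move=> pf pg ph; rewrite /drotate; polytime_tac. Qed.

Ltac polytime_arith := repeat first
  [ polytime_step
  | match goal with
    | |- polytime (fun x => deq (@?f x) (@?g x)) => apply: (@polytime_eq f g)
    | |- polytime (fun x => dlt (@?f x) (@?g x)) => apply: (@polytime_lt f g)
    | |- polytime (fun x => dtransp (@?f x) (@?g x) (@?h x)) =>
        apply: (@polytime_transp f g h)
    | |- polytime (fun x => drotate (@?f x) (@?g x) (@?h x)) =>
        apply: (@polytime_rotate f g h)
    end ].

Lemma deqE x y : deq (Atom x) (Atom y) = Atom (x == y).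
Proof. by rewrite /deq /dleq /= eqn_leq; case: (x <= y). Qed.
Lemma dltE x y : dlt (Atom x) (Atom y) = Atom (x < y).
Proof. by rewrite /dlt /dleq /= addn1. Qed.
Lemma dtranspE a b u : dtransp (Atom a) (Atom b) (Atom u) = Atom (transp a b u).
Proof. by rewrite /dtransp !deqE /transp; case: (u == a); case: (u == b). Qed.
Lemma drotateE m k u : drotate (Atom m) (Atom k) (Atom u) = Atom (rotate m k u).
Proof. by rewrite /drotate /dleq /rotate /=; case: (m <= u + k). Qed.

Definition enc_block (b : block) : data :=
  Cons (Atom (blk_free b)) (Cons (Atom (blk_y b)) (Cons (Atom (blk_z b))
    (Cons (Atom (blk_p b)) (Cons (Atom (blk_q b)) (Atom (blk_r b)))))).
Definition dfree b := dcar b.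
Definition dy b := dcar (dcdr b).
Definition dz b := dcar (dcdr (dcdr b)).
Definition dp b := dcar (dcdr (dcdr (dcdr b))).
Definition dq b := dcar (dcdr (dcdr (dcdr (dcdr b)))).
Definition dr b := dcdr (dcdr (dcdr (dcdr (dcdr b)))).

Definition dorder b u :=
  dtransp (dtransp (dy b) (dp b) (dz b)) (dq b) (dtransp (dy b) (dp b) u).

Lemma polytime_order f g :
  polytime f -> polytime g -> polytime (fun x => dorder (f x) (g x)).
Proof.
move=> pf pg; rewrite /dorder /dy /dz /dp /dq.
by polytime_arith.
Qed.

Lemma dorderE b u : dorder (enc_block b) (Atom u) = Atom (block_order b u).
Proof. by rewrite /dorder !dtranspE. Qed.

Definition drel m b k u v :=
  dif (deq k (Atom 0))
    (dif (dfree b)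
      (dif (dlt (dorder b u) (dorder b v))
        (dif (deq u (dy b)) (dlt (dr b) (dorder b v)) (Atom 1)) (Atom 0))
      (dlt (dorder b (dtransp (dy b) (dz b) u)) (dorder b (dtransp (dy b) (dz
        b) v))))
    (dlt (drotate m k (dorder b u)) (drotate m k (dorder b v))).

Lemma polytime_rel m b k u v :
  polytime m -> polytime b -> polytime k -> polytime u -> polytime v ->
  polytime (fun x => drel (m x) (b x) (k x) (u x) (v x)).
Proof.
move=> pm pb pk pu pv; rewrite /drel /dfree /dy /dz /dr.
by repeat first
  [ progress polytime_arith
  | match goal with
    | |- polytime (fun x => dorder (@?f x) (@?g x)) =>
      apply: (@polytime_order f g)
    end ].
Qed.

Lemma drelE m b k u v :
  drel (Atom m) (enc_block b) (Atom k) (Atom u) (Atom v) =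
    Atom (block_rel m b k u v).
Proof.
rewrite /drel !dorderE !dtranspE !dorderE !drotateE !deqE !dltE /block_rel.
case: (k == 0) => //=; case: (blk_free b) => //=.
case: (_ < _) => //=; case: (_ == _) => //=.
by rewrite ltnNge.
Qed.

Definition dvote m b k cand :=
  dflat (dmap (fun u => dmap (fun v => Cons u v)
    (dfilter (fun v => drel m b k u v) cand)) cand).

(** The candidate list doubles as the list of shifts, both being [0 .. m - 1]. *)
Definition dblock_votes m b cand := dmap (fun k => dvote m b k cand) cand.

Lemma polytime_block_votes m b cand :
  polytime m -> polytime b -> polytime cand ->
  polytime (fun x => dblock_votes (m x) (b x) (cand x)).
Proof.
apply: polytime_comp3; rewrite /dblock_votes /dvote; polytime_tac.
by apply: polytime_rel; polytime_tac.
Qed.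

Definition enc_vote m (v : vote m) : data :=
  enc_list (fun p : 'I_m * 'I_m => Cons (Atom p.1) (Atom p.2)) v.

Lemma dvoteE m b k : dvote (Atom m) (enc_block b) (Atom k) (dlist (map Atom
  (iota 0 m))) =
  enc_vote (order_of_rel m (block_rel m b k)).
Proof.
rewrite /dvote dmapE /enc_vote enc_listE /order_of_rel map_flatten -dflatE.
rewrite -!map_comp; congr (dflat (dlist _)).
rewrite -val_enum_ord -!map_comp; apply: eq_map => u /=.
rewrite (@dfilterE _ (fun v : 'I_m => Atom v) _ (fun v : 'I_m =>
  block_rel m b k u v)).
  by rewrite dmapE -!map_comp enumT.
by move=> v; rewrite drelE.
Qed.

Lemma dblock_votesE m b :
  dblock_votes (Atom m) (enc_block b) (dlist (map Atom (iota 0 m))) =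
  dlist (map (@enc_vote m) (block_votes m b)).
Proof.
rewrite /dblock_votes dmapE /block_votes -!map_comp; congr dlist.
by apply: eq_map => k /=; rewrite dvoteE.
Qed.

(** * The program for the reduction *)

Definition delts inp := dcar (dcar inp).
Definition dfam inp := dcdr (dcar inp).
Definition dalpha (inp : data) := dcdr inp.
Definition dn inp := dlen (delts inp).
Definition dt inp := dlen (dfam inp).
Definition dm inp := dlen (dalpha inp).
Definition dM inp := dsub (dm inp) (dadd (dadd (dn inp) (dt inp)) (Atom 2)).
Definition dcand inp := diota (dalpha inp).
Definition dpt inp k := dnth k (dalpha inp).
Definition dS x := dadd x (Atom 1).
Definition dand x y := dif x y (Atom 0).

Definition dtop_drop inp := dcar (dfilter (fun k =>
  dand (dlt (dS k) (dM inp)) (dand (dleq (dpt inp (Atom 0)) (dpt inp k))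
    (dlt (dpt inp (dS k)) (dpt inp k)))) (dcand inp)).

Definition dtriple x := dadd x (dadd x x).

Definition dsmall_drop inp := dcar (dfilter (fun k =>
  dand (dlt (dS k) (dM inp)) (dand (dlt (dpt inp (dS k)) (dpt inp k))
    (dleq (dtriple (dsub (dpt inp k) (dpt inp (dS k))))
      (dsub (dpt inp (Atom 0)) (dpt inp (dsub (dM inp) (Atom 1)))))))
  (dcand inp)).

Definition dBlock f y z p q r :=
  Cons f (Cons y (Cons z (Cons p (Cons q r)))).

Definition dblocks inp a j :=
  dcat (dmap (fun i => dBlock (Atom 1) (dadd (dadd (dM inp) (dn inp)) i)
      (dadd (dadd (dM inp) (dn inp)) (dt inp)) a (dS a) (dsub (dM inp) (Atom
        1)))
    (diota (dfam inp)))
 (dcat (dflat (dmap (fun i => dmap (fun e =>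
      dBlock (Atom 1) (dadd (dM inp) e) (dadd (dadd (dM inp) (dn inp)) i) j (dS
        j) (dS j))
      (dnth i (dfam inp))) (diota (dfam inp))))
 (dcat (dmap (fun e => dBlock (Atom 0) (Atom 0) (dadd (dM inp) e) j (dS j)
   (Atom 0))
    (diota (delts inp)))
 (dcat (dflat (dmap (fun _ => dmap (fun z =>
      dBlock (Atom 0) (Atom 0) z (Atom 0) (dsub (dm inp) (Atom 1)) (Atom 0))
      (dfilter (fun z => dleq (dM inp) z) (dcand inp))) (dcand inp)))
   (dmap (fun _ => dBlock (Atom 0) (dadd (dadd (dM inp) (dn inp)) (dt inp))
     (Atom 0)
      a (dS a) (Atom 0))
    (dfilter (fun k => dleq (dadd (dtriple k) (Atom 3)) (dn inp)) (dcand
      inp)))))).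

Definition delection inp := Cons
  (dflat (dmap (fun b => dblock_votes (dm inp) b (dcand inp))
    (dblocks inp (dtop_drop inp) (dsmall_drop inp)))) (dsub (dm inp) (Atom 1)).

(** The input here is an X3C instance alone, without a scoring vector. *)
Definition dvalues inp :=
  dadd (dadd (dadd (dlen (dcar inp)) (dlen (dcar inp)))
    (dadd (dtriple (dlen (dcdr inp))) (dadd (dlen (dcdr inp)) (dlen (dcdr
      inp)))))
    (Atom 6).

Ltac polytime_unfold := rewrite /dand /dtriple /dS /dpt /dM /dcand /dn /dt /dm
  /delts /dfam /dalpha /dlt /dBlock.

Lemma polytime_top_drop : polytime dtop_drop.
Proof. by rewrite /dtop_drop; polytime_unfold; polytime_tac. Qed.

Lemma polytime_small_drop : polytime dsmall_drop.
Proof. by rewrite /dsmall_drop; polytime_unfold; polytime_tac. Qed.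

Lemma polytime_blocks f g h : polytime f -> polytime g -> polytime h ->
  polytime (fun x => dblocks (f x) (g x) (h x)).
Proof.
by apply: polytime_comp3; rewrite /dblocks; polytime_unfold; polytime_tac.
Qed.

Lemma polytime_election : polytime delection.
Proof.
apply: polytime_cons; last by polytime_unfold; polytime_tac.
apply/polytime_flat/polytime_map.
  by apply: polytime_block_votes; polytime_unfold; polytime_tac.
apply: polytime_blocks; first exact: polytime_id.
  exact: polytime_top_drop.
exact: polytime_small_drop.
Qed.

Lemma polytime_values : polytime dvalues.
Proof. by rewrite /dvalues; polytime_unfold; polytime_tac. Qed.

(** * The program outputs the encoded election *)

Section ElectionCorrect.

Variables (m n : nat) (alpha : m.-tuple nat) (fam : seq (seq nat)).
Local Notation t := (size fam).
Local Notation M := (m - (n + t + 2)).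
Let inp := Cons (Cons (dlist (map Atom (iota 0 n)))
  (dlist (map (fun s => dlist (map Atom s)) fam))) (dlist (map Atom alpha)).

Lemma dnE : dn inp = Atom n.
Proof. by rewrite /dn /= dlenE size_map size_iota. Qed.
Lemma dtE : dt inp = Atom t.
Proof. by rewrite /dt /= dlenE size_map. Qed.
Lemma dmE : dm inp = Atom m.
Proof. by rewrite /dm /= dlenE size_map size_tuple. Qed.
Lemma dME : dM inp = Atom M.
Proof. by rewrite /dM dmE dnE dtE. Qed.
Lemma dcandE : dcand inp = dlist (map Atom (iota 0 m)).
Proof. by rewrite /dcand /= diotaE size_map size_tuple. Qed.
Lemma dptE k : dpt inp (Atom k) = Atom (points alpha k).
Proof.
rewrite /dpt /= dnthE /points; have [km|mk] := ltnP k (size alpha).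
  by rewrite (nth_map 0).
by rewrite !nth_default ?size_map.
Qed.
Lemma dSE k : dS (Atom k) = Atom k.+1.
Proof. by rewrite /dS /dadd /= addn1. Qed.
Lemma dandE (x y : bool) : dand (Atom x) (Atom y) = Atom (x && y).
Proof. by case: x. Qed.
Lemma dleqE x y : dleq (Atom x) (Atom y) = Atom (x <= y).
Proof. by []. Qed.
Lemma dtripleE x : dtriple (Atom x) = Atom (3 * x).
Proof. by rewrite /dtriple /dadd /= -[in RHS](addn2 1) mulnDl mul1n mul2n
  -addnn. Qed.

Lemma head_map_Atom s : head (Atom 0) (map Atom s) = Atom (head 0 s).
Proof. by case: s. Qed.

Lemma dtop_dropE : dtop_drop inp = Atom (top_drop alpha M).
Proof.
rewrite /dtop_drop dcandE (@dfilterE _ Atom _ (is_top_drop alpha M)).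
  by rewrite dcarE head_map_Atom.
by move=> k; rewrite dME !dSE !dptE !dltE dleqE !dandE.
Qed.

Lemma dsmall_dropE : dsmall_drop inp = Atom (small_drop alpha M).
Proof.
rewrite /dsmall_drop dcandE (@dfilterE _ Atom _ (is_small_drop alpha M)).
  by rewrite dcarE head_map_Atom.
move=> k; rewrite dME !dSE !dptE !dltE dtripleE dleqE !dandE.
by rewrite [M - 1]subn1.
Qed.

Lemma dblocksE a j : dblocks inp (Atom a) (Atom j) =
  dlist (map enc_block (reduction_blocks m n fam a j)).
Proof.
rewrite /dblocks !dME dnE dtE dmE dcandE !dSE /dfam /delts /= !diotaE !size_map
  size_iota.
rewrite /reduction_blocks !map_cat -!dcatE;
  congr (dcat _ (dcat _ (dcat _ (dcat _ _)))).
- rewrite dmapE -!map_comp; congr dlist; apply: eq_map => i /=.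
  by rewrite /dsub /= subn1.
- rewrite dmapE /incidences !map_flatten -dflatE -!map_comp.
  congr (dflat (dlist _)); apply: eq_map => i /=.
  (* Beyond the family both defaults agree, as [Atom 0] encodes the empty list. *)
  rewrite dnthE; have -> : nth (Atom 0) [seq dlist (map Atom s) | s <- fam] i =
      dlist (map Atom (nth [::] fam i)).
    have [it|ti] := ltnP i t; first by rewrite (nth_map [::]).
    by rewrite !nth_default ?size_map.
  by rewrite dmapE -!map_comp.
- by rewrite dmapE -!map_comp.
- rewrite dmapE /sink_dummies map_flatten -dflatE -!map_comp.
  congr (dflat (dlist _)); apply: eq_map => i /=.
  rewrite (@dfilterE _ Atom _ (fun z => M <= z)) //.
  by rewrite dmapE -!map_comp; congr dlist; apply: eq_map => z /=;
    rewrite /dsub /= subn1.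
- rewrite (@dfilterE _ Atom _ (fun k => 3 * k + 3 <= n)).
    by rewrite dmapE -!map_comp.
  by move=> k; rewrite dtripleE.
Qed.

Lemma delectionE (c : 'I_m) : c = m.-1 :> nat ->
  delection inp = enc_election (reduction_votes m n fam (top_drop alpha M)
    (small_drop alpha M)) c.
Proof.
move=> cE; rewrite /delection dmE dtop_dropE dsmall_dropE dblocksE dcandE
  /enc_election.
congr Cons; last by rewrite /dsub /= subn1 cE.
rewrite dmapE enc_listE /reduction_votes map_flatten -dflatE -!map_comp.
congr (dflat (dlist _)); apply: eq_map => b /=.
by rewrite dblock_votesE.
Qed.

End ElectionCorrect.

(** * Encoded instances and the number of score values *)

Lemma enc_x3cE (I : x3c) : enc_x3c I =
  Cons (dlist (map Atom (iota 0 (x3c_card I))))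
  (dlist (map (fun s => dlist (map Atom s)) (family_lists I))).
Proof.
rewrite /enc_x3c !enc_listE -val_enum_ord -!map_comp; congr (Cons _ (dlist _)).
by apply: eq_map => X /=; rewrite enc_listE -map_comp.
Qed.

Lemma leq_size_dlist s : 2 * size s < dsize (dlist s).
Proof. by elim: s => //= x s IH; have := dsize_gt0 x; lia. Qed.

Lemma dsize_map_Atom (A : Type) (f : A -> nat) s : dsize (dlist (map (fun x =>
  Atom (f x)) s)) = 2 * size s + 1.
Proof. by elim: s => //= x s ->; lia. Qed.

(** With [n] elements and [t] sets, this is [n + t + 2] for the non-dummies, 4 for [four_values],
    and [n + 4 * t], which is at least the number of times a dummy can gain points. *)
Definition values_needed (I : x3c) : nat :=
  2 * x3c_card I + 5 * size (x3c_family I) + 6.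

Lemma values_needed_size I : values_needed I <= 5 * x3c_size I + 6.
Proof.
rewrite /x3c_size enc_x3cE /=.
have := leq_size_dlist (map Atom (iota 0 (x3c_card I))).
have := leq_size_dlist (map (fun s => dlist (map Atom s)) (family_lists I)).
by rewrite !size_map size_iota /values_needed; lia.
Qed.

Lemma dvaluesE I : dvalues (enc_x3c I) = Atom (values_needed I).
Proof.
rewrite /dvalues enc_x3cE /= !dlenE !size_map size_iota dtripleE /dadd /=.
by congr Atom; rewrite /values_needed; lia.
Qed.

Lemma reduction_correct (I : x3c) (m : nat) (alpha : m.-tuple nat)
    (J : {set 'I_m}) (c : 'I_m) :
  scoring_vector alpha -> {in J &, injective (tnth alpha)} ->
  values_needed I <= #|J| -> c = m.-1 :> nat ->
  let fam := family_lists I in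
  let M := m - (x3c_card I + size fam + 2) in
  possible_winner alpha (reduction_votes m (x3c_card I) fam
    (top_drop alpha M) (small_drop alpha M)) c <-> x3c_yes I.
Proof.
move=> [m0 alpha_sorted alpha_last] injJ cardJ cE fam M.
have sz : size fam = size (x3c_family I) by apply: size_map.
have Jm : #|J| <= m by rewrite -[X in _ <= X]card_ord max_card.
have m_large : 2 * x3c_card I + 5 * size fam + 6 <= m.
  by rewrite sz; apply: leq_trans cardJ Jm.
have mE : m = M + (x3c_card I + size fam + 2) by rewrite /M subnK //; lia.
have last0 : points alpha m.-1 = 0.
  by move: alpha_last; rewrite -nth_last size_tuple.
have [|/and3P[a1 a2 a3] /and3P[j1 j2 j3]] := drops_exist alpha_sorted mE injJ.
  by apply: leq_trans cardJ; rewrite /values_needed sz; lia.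
have a_top : points alpha (top_drop alpha M) = points alpha 0.
  by have := points_anti alpha_sorted (leq0n (top_drop alpha M)); lia.
have fam_size i : i < size fam -> size (nth [::] fam i) = 3.
  rewrite sz => it; rewrite (nth_map set0) // size_map -cardE.
  by apply/eqP; apply: (allP (x3c_family3 I)); apply: mem_nth.
have fam_uniq i : uniq (nth [::] fam i).
  have [it|ti] := ltnP i (size (x3c_family I)); last first.
    by rewrite nth_default // sz.
  by rewrite (nth_map set0) // map_inj_uniq ?enum_uniq //; apply: val_inj.
have fam_lt i e : e \in nth [::] fam i -> e < x3c_card I.
  have [it|ti] := ltnP i (size (x3c_family I)); last first.
    by rewrite nth_default // sz.
  rewrite (nth_map set0) // => /mapP[u _ ->]; exact: ltn_ord.
rewrite x3c_yesE; split=> [win|[beta cover]].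
  by apply: (exact_cover_of_winner _ _ _ _ _ _ _ _ _ _ _ _ cE win).
by apply: (winner_of_exact_cover _ _ _ _ _ _ _ _ _ _ _ _ cE cover).
Qed.

Theorem theorem1 :
  exists f : x3c -> nat,
    [/\ exists F : prog, exists p : {poly nat}, forall I : x3c,
          runs_within F (enc_x3c I) (Atom (f I)) (p.[x3c_size I])%R,
        exists q : {poly nat}, forall I : x3c, f I <= (q.[x3c_size I])%R
      & exists R : prog, exists p : {poly nat},
          forall (I : x3c) (m : nat) (alpha : m.-tuple nat),
            scoring_vector alpha ->
            forall J : {set 'I_m}, {in J &, injective (tnth alpha)} ->
            f I <= #|J| ->
            exists (V : seq (vote m)) (c : 'I_m),
              [/\ runs_within R (enc_input I alpha) (enc_election V c)
                    (p.[(x3c_size I + m)%N])%R,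
                  forall v, v \in V -> partial_vote v
                & possible_winner alpha V c <-> x3c_yes I]].
Proof.
exists values_needed; split.
- have [F [b pb HF]] := polytime_values; have [p pE] := poly_bound_poly pb.
  by exists F, p => I; rewrite -pE -dvaluesE; apply: HF.
- have pb : poly_bound (fun k => 5 * k + 6) by poly_bound_tac.
  have [q qE] := poly_bound_poly pb.
  by exists q => I; rewrite -qE; apply: values_needed_size.
have [R [b pb HR]] := polytime_election.
(* The encoded input has size [x3c_size I + 2 * m + 2], since each score costs an atom and a
   cell. *)
have pb2 : poly_bound (fun k => b (2 * k + 2)).
  by apply: (poly_bound_comp pb); poly_bound_tac.
have [p pE] := poly_bound_poly pb2.
exists R, p => I m alpha sv J injJ cardJ.
have m1 : m.-1 < m by rewrite prednK //; case: sv.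
exists (reduction_votes m (x3c_card I) (family_lists I)
  (top_drop alpha (m - (x3c_card I + size (family_lists I) + 2)))
  (small_drop alpha (m - (x3c_card I + size (family_lists I) + 2)))),
    (Ordinal m1).
split.
- have inpE : enc_input I alpha =
  Cons (Cons (dlist (map Atom (iota 0 (x3c_card I))))
      (dlist (map (fun s => dlist (map Atom s)) (family_lists I))))
      (dlist (map Atom alpha)).
    by rewrite /enc_input enc_x3cE enc_listE.
  rewrite -delectionE // -inpE -pE.
  have [T eT leT] := HR (enc_input I alpha); exists T => //.
  apply: (leq_trans leT); apply: (poly_bound_mono pb).
  rewrite -[dsize _]/(x3c_size I + dsize (enc_list Atom alpha)).+1 enc_listE.
  by rewrite (dsize_map_Atom id) size_tuple; lia.
- rewrite /reduction_votes;
  elim: (reduction_blocks _ _ _ _ _) => //= blk bs IH v.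
  by rewrite mem_cat => /orP[/block_partial_vote|/IH].
- exact: reduction_correct injJ cardJ _.
Qed.
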